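(* Let $1<p<\infty$, let $\frac1p+\frac1{p'}=1$, and let $\omega,\nu,\eta$ be radial weights. Then the following statements are equivalent: (i) $T_\omega:L^p_\nu\to L^{p,\infty}_\eta$ is bounded; (ii) $\displaystyle N_p(\omega,\nu,\eta)=\sup_{0\le t<r<1}\left(\frac{\int_t^r\eta(s)s\,ds}{\widehat\omega(t)^p}\right)^{\frac1p}\left(\int_r^1\left(\frac{\omega(s)}{s\nu(s)}\right)^{p'}s\nu(s)\,ds\right)^{\frac1{p'}}<\infty$; (iii) $\displaystyle M_{p,\varepsilon}(\omega,\nu,\eta)=\sup_{0\le r<1}\left(\widehat\omega(r)^{\varepsilon}\int_0^r\frac{s\eta(s)}{\widehat\omega(s)^{p+\varepsilon}}\,ds\right)^{\frac1p}\left(\int_r^1\left(\frac{\omega(s)}{s\nu(s)}\right)^{p'}s\nu(s)\,ds\right)^{\frac1{p'}}<\infty$ for some (equivalently for each) $\varepsilon>0$. Moreover, for each fixed $\varepsilon>0$, $$\|T_\omega\|_{L^p_\nu\to L^{p,\infty}_\eta}\asymp N_p(\omega,\nu,\eta)\asymp M_{p,\varepsilon}(\omega,\nu,\eta).$$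
   Context: $\mathbb D$ is the open unit disc and $dA(z)=\frac{dx\,dy}{\pi}$. A weight is a function $\omega:\mathbb D\to[0,\infty)$ integrable over $\mathbb D$; it is radial if $\omega(z)=\omega(|z|)$ for all $z\in\mathbb D$. For a radial weight, $\widehat\omega(z)=\int_{|z|}^1\omega(s)\,ds$, and it is assumed throughout that $\widehat\omega(z)>0$ for all $z\in\mathbb D$. For a measurable set $E\subset\mathbb D$, $\eta(E)=\int_E\eta\,dA$. $L^p_\nu$ is the space of complex-valued measurable functions $f$ on $\mathbb D$ with $\|f\|_{L^p_\nu}^p=\int_{\mathbb D}|f|^p\nu\,dA<\infty$. The radial averaging operator is $$T_\omega(f)(z)=\frac{1}{\widehat\omega(z)}\int_{|z|}^1 f\left(s\tfrac{z}{|z|}\right)\omega(s)\,ds,\quad z\in\mathbb D\setminus\{0\}.$$ $T_\omega:L^p_\nu\to L^{p,\infty}_\eta$ is bounded if there is a constant $C$ such that $\lambda^p\,\eta(\{z\in\mathbb D:|T_\omega(f)(z)|>\lambda\})\le C^p\|f\|_{L^p_\nu}^p$ for all $\lambda>0$ and $f\in L^p_\nu$; $\|T_\omega\|_{L^p_\nu\to L^{p,\infty}_\eta}$ is the least such $C$. The conventions $0\cdot\infty=0$ and $1/0=\infty$ are used. The notation $a\lesssim b$ means that there exists a constant $C>0$ such that $a\le Cb$, and $a\asymp b$ means that $a\lesssim b$ and $b\lesssim a$.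
   Formalization: Where ν(s)=0<ω(s), the integrand (ω/(sν))^{p'}sν is taken to be ∞, not ∞·0=0 as the stated conventions give; with 0 the claim fails (ω=η=1, ν=0 on 1/4<|z|<1/2 and 1 elsewhere). Measurable means Borel measurable. *)

(* Defs.v *)
From mathcomp Require Import all_boot all_order all_algebra.
From mathcomp Require Import complex.
From mathcomp Require Import all_classical all_reals all_analysis.

Set Implicit Arguments.
Unset Strict Implicit.
Unset Printing Implicit Defensive.

Import Order.TTheory GRing.Theory Num.Theory.
Import numFieldNormedType.Exports.

Local Open Scope classical_set_scope.
Local Open Scope complex_scope.
Local Open Scope ring_scope.

(* Points of the complex plane, and the values of functions, are in R[i].
   Measurability and integration over the plane go through the identification
   of R * R (product Borel sigma-algebra, product Lebesgue measure) with R[i]. *)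
Definition cpt (R : realType) (w : R * R) : R[i] := w.1 +i* w.2.

Definition modc (R : realType) (z : R[i]) : R := Normc.normc z.

Definition disc (R : realType) : set R[i] := [set z | modc z < 1].

Definition leb (R : realType) : {measure set (measurableTypeR R) -> \bar R} :=
  @lebesgue_measure R.

Lemma invpi_ge0 (R : realType) : 0 <= (pi : R)^-1.
Proof. by rewrite invr_ge0 pi_ge0. Qed.

Definition dA (R : realType) :
    {measure set (measurableTypeR R * measurableTypeR R)%type -> \bar R} :=
  mscale (NngNum (invpi_ge0 R)) (@leb R \x @leb R)%E.

Definition int_dA (R : realType) (E : set R[i]) (g : R[i] -> \bar R) : \bar R :=
  (\int[@dA R]_(w in @cpt R @^-1` E) g (cpt w))%E.

Definition weight (R : realType) (w : R[i] -> R) : Prop :=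
  (forall z, @disc R z -> 0 <= w z) /\
  (@dA R).-integrable (@cpt R @^-1` @disc R) (fun x => (w (cpt x))%:E).

Definition radial (R : realType) (w : R[i] -> R) : Prop :=
  forall z, @disc R z -> w z = w (modc z)%:C.

(* The tail integral depends only on |z|, so it is a function of r = |z|. It
   may be +oo at r = 0, and only there for a weight: w(s) s is integrable. *)
Definition tail (R : realType) (w : R[i] -> R) (r : R) : \bar R :=
  (\int[@leb R]_(s in `[r, 1%R[) (w s%:C)%:E)%E.

Definition radial_weight (R : realType) (w : R[i] -> R) : Prop :=
  [/\ weight w, radial w & forall z, @disc R z -> (0 < tail w (modc z))%E].

Definition wmeas (R : realType) (h : R[i] -> R) (E : set R[i]) : \bar R :=
  int_dA E (fun z => (h z)%:E).

Definition cmeasurable (R : realType) (f : R[i] -> R[i]) : Prop :=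
  let D := @cpt R @^-1` @disc R in
  measurable_fun D (fun x : measurableTypeR R * measurableTypeR R =>
    (complex.Re (f (cpt x)) : measurableTypeR R)) /\
  measurable_fun D (fun x : measurableTypeR R * measurableTypeR R =>
    (complex.Im (f (cpt x)) : measurableTypeR R)).

Definition Lpnorm_pow (R : realType) (p : R) (v : R[i] -> R)
    (f : R[i] -> R[i]) : \bar R :=
  int_dA (@disc R) (fun z => (modc (f z) `^ p * v z)%:E).

Definition Lp (R : realType) (p : R) (v : R[i] -> R) : set (R[i] -> R[i]) :=
  [set f | cmeasurable f /\ (Lpnorm_pow p v f < +oo)%E].

Definition ray (R : realType) (z : R[i]) (s : R) : R[i] :=
  s%:C * (z / (modc z)%:C).

Definition Tavg_defined (R : realType) (w : R[i] -> R) (f : R[i] -> R[i])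
    (z : R[i]) : Prop :=
  (@leb R).-integrable `[modc z, 1%R[
    (fun s => (complex.Re (f (ray z s)) * w s%:C)%:E) /\
  (@leb R).-integrable `[modc z, 1%R[
    (fun s => (complex.Im (f (ray z s)) * w s%:C)%:E).

(* Meaningful at those z <> 0 of the disc where Tavg_defined w f z. *)
Definition Tavg (R : realType) (w : R[i] -> R) (f : R[i] -> R[i]) (z : R[i]) :
    R[i] :=
  ((fine (tail w (modc z)))^-1)%:C *
  ((\int[@leb R]_(s in `[modc z, 1%R[) (complex.Re (f (ray z s)) * w s%:C)) +i*
   (\int[@leb R]_(s in `[modc z, 1%R[) (complex.Im (f (ray z s)) * w s%:C))).

Definition level_set (R : realType) (w : R[i] -> R) (f : R[i] -> R[i])
    (lam : R) : set R[i] :=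
  [set z | [/\ @disc R z, z != 0 & lam < modc (Tavg w f z)]].

Definition divergence_set (R : realType) (w : R[i] -> R) (f : R[i] -> R[i]) :
    set R[i] :=
  [set z | [/\ @disc R z, z != 0 & ~ Tavg_defined w f z]].

(* C is a bound for Tavg w : L^p_v -> L^{p,oo}_h. The first conjunct says that
   the integral defining Tavg w f converges absolutely h-almost everywhere, so
   that Tavg w f is an element of L^{p,oo}_h; without it the inequality would
   be about the default value 0 of divergent integrals. *)
Definition weak_bound (R : realType) (p : R) (w v h : R[i] -> R) (C : R) :
    Prop :=
  forall f, Lp p v f ->
    wmeas h (divergence_set w f) = 0%E /\
    forall lam : R, 0 < lam ->
      ((lam `^ p)%:E * wmeas h (level_set w f lam) <=
       (C `^ p)%:E * Lpnorm_pow p v f)%E.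

Definition Tavg_bounded (R : realType) (p : R) (w v h : R[i] -> R) : Prop :=
  exists2 C : R, 0 <= C & weak_bound p w v h C.

(* +oo if Tavg w is not bounded *)
Definition Tavg_norm (R : realType) (p : R) (w v h : R[i] -> R) : \bar R :=
  ereal_inf [set C%:E | C in [set C : R | 0 <= C /\ weak_bound p w v h C]].

(* (w(s)/(s v(s)))^q s v(s), understood as w(s)^q (s v(s))^(1-q) with
   1/0 = oo and 0 oo = 0: where v vanishes it is oo if w(s) > 0, and 0 if
   w(s) = 0. Multiplying oo by the last factor s v(s) = 0 would instead
   make the sets where v = 0 < w invisible. *)
Definition dual_density (R : realType) (q : R) (w v : R[i] -> R) (s : R) :
    \bar R :=
  if s * v s%:C == 0 then ((w s%:C)%:E * +oo)%E
  else ((w s%:C / (s * v s%:C)) `^ q * (s * v s%:C))%:E.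

Local Open Scope ereal_scope.

Definition dual_int (R : realType) (q : R) (w v : R[i] -> R) (r : R) : \bar R :=
  \int[@leb R]_(s in `[r, 1%R[) dual_density q w v s.

(* In Np and Mp, the arithmetic of \bar R has 0 * +oo = 0, 0^-1 = +oo and
   (+oo)^-1 = 0. *)
Definition Np (R : realType) (p q : R) (w v h : R[i] -> R) : \bar R :=
  ereal_sup [set x | exists t r : R, [/\ (0 <= t)%R, (t < r)%R, (r < 1)%R &
    x = ((\int[@leb R]_(s in `[t, r]) (h s%:C * s)%:E) / (tail w t `^ p))
          `^ (p^-1)%R * (dual_int q w v r) `^ (q^-1)%R]].

Definition Mp (R : realType) (p q eps : R) (w v h : R[i] -> R) : \bar R :=
  ereal_sup [set x | exists r : R, [/\ (0 <= r)%R, (r < 1)%R &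
    x = (tail w r `^ eps *
          \int[@leb R]_(s in `[0%R, r])
            ((s * h s%:C)%:E / (tail w s `^ (p + eps)%R)))
          `^ (p^-1)%R * (dual_int q w v r) `^ (q^-1)%R]].

(* Main.v *)
(** Along each ray the problem is one-dimensional: integration in polar
    coordinates (through slopes, so that no trigonometry is needed) transfers
    a weak-type inequality on every ray to the disc.

    Sufficiency of (ii).  With [G r] the integral of [|f| w] over [[r, 1)], the
    bad set on a ray is [{G > lam Om}], [Om] the tail of [w].  It is cut into the
    dyadic levels [c 2^-(k+1) < G <= c 2^-k] of [G].  On a segment [[t, s]] with
    ends in one level, the part of the integral [G s] taken where
    [G > c 2^-(k+2)] is comparable to [G s]; Hoelder's inequality on that part
    and the condition at [(t, s)] bound the measure of the segment by
    [lam^-p] times the integral of [|f|^p v] over two levels, and the levels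
    overlap boundedly.

    Necessity of (ii).  Test on radial truncations of [(w / (s v))^(q-1)] on
    [[r, 1)] and let the truncation go to infinity.

    (ii) <-> (iii).  Cut according to the dyadic levels of [Om]: on each level
    [Om] is essentially constant and the powers of [2] sum geometrically. *)
Require Import Defs.
From mathcomp Require Import all_boot all_order all_algebra.
From mathcomp Require Import complex.
From mathcomp Require Import all_classical all_reals all_analysis.
From mathcomp Require Import measurable_realfun.
From mathcomp Require Import ring lra.

Set Implicit Arguments.
Unset Strict Implicit.
Unset Printing Implicit Defensive.

Import Order.TTheory GRing.Theory Num.Theory.
Import numFieldNormedType.Exports.

Local Open Scope classical_set_scope.
Local Open Scope ring_scope.

(** * Integration in polar coordinates *)

Section IntegralTools.
Import HBNNSimple.
Local Open Scope ereal_scope.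

(* Measurability is not assumed: the integral of a nonnegative function is a
   supremum over the simple functions below it.  Level sets of [Tavg w f] are
   handled in this way, without proving them measurable. *)
Lemma ge0_le_integral_nonmeasurable d (T : measurableType d) (R : realType)
    (mu : {measure set T -> \bar R}) (D : set T) (f g : T -> \bar R) :
  (forall x, D x -> 0 <= f x) -> (forall x, D x -> f x <= g x) ->
  \int[mu]_(x in D) f x <= \int[mu]_(x in D) g x.
Proof.
move=> f0 fg; have g0 x : D x -> 0 <= g x by move=> Dx; exact: le_trans (f0 _ Dx) (fg _ Dx).
rewrite !ge0_integralE//; apply: le_ereal_sup => _ [h hf <-]; exists h => //= x.
apply: le_trans (hf x) _; rewrite !patchE; case: ifPn => // /set_mem Dx; exact: fg.
Qed.

Lemma ge0_le_integral_nnsfun d (T : measurableType d) (R : realType)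
    (mu : {measure set T -> \bar R}) (f : T -> \bar R) (b : \bar R) :
  (forall x, 0 <= f x) ->
  (forall h : T -> R, measurable_fun setT h -> (forall x, (0 <= h x)%R) ->
     (forall x, (h x)%:E <= f x) -> \int[mu]_x (h x)%:E <= b) ->
  \int[mu]_x f x <= b.
Proof.
move=> f0 H; rewrite ge0_integralTE//; apply: ge_ereal_sup => _ [h hf <-].
by rewrite -integralT_nnsfun; apply: H => // x; exact: (@fun_ge0 _ _ h).
Qed.

Lemma lebesgue_measure_scale (R : realType) (c : R) (A : set R) : c != 0%R ->
  measurable A ->
  @leb R ((fun x : measurableTypeR R => c * x : measurableTypeR R)%R @^-1` A) =
  `|c|^-1%:E * @leb R A.
Proof.
move=> c0 mA.
have mc : measurable_fun setT
    (fun x : measurableTypeR R => c * x : measurableTypeR R)%R.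
  exact: mulrl_measurable.
have ac : (0 < `|c|)%R by rewrite normr_gt0.
pose m1 : {measure set (measurableTypeR R) -> \bar R} :=
  measure_function_pushforward__canonical__measure_function_Measure (@leb R) mc.
pose m2 : {measure set (measurableTypeR R) -> \bar R} :=
  mscale (NngNum (ltW ac)) m1.
suff -> : @leb R A = m2 A.
  by rewrite /m2 /mscale/= muleA -EFinM mulVf ?gt_eqF// mul1e.
apply: lebesgue_measure_unique => //= _ [[a b]] _ <-.
rewrite /m2 /mscale /m1/= /pushforward.
have [c_gt0|c_le0] := ltP 0%R c.
  rewrite (_ : _ @^-1` _ = `](a / c)%R, (b / c)%R]%classic); last first.
    apply/seteqP; split => x /=; rewrite !in_itv/= ltr_pdivrMr// ler_pdivlMr//;
      by rewrite ![(c * x)%R]mulrC.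
  rewrite /leb/= !lebesgue_measure_itv/= !lte_fin gtr0_norm//.
  rewrite ltr_pM2r ?invr_gt0//; case: ifPn => _; last by rewrite mule0.
  by rewrite -!EFinB -EFinM; congr EFin; field.
have c_lt0 : (c < 0)%R by rewrite lt_neqAle c0.
rewrite (_ : _ @^-1` _ = `[(b / c)%R, (a / c)%R[%classic); last first.
  apply/seteqP; split => x /=; rewrite !in_itv/= ltr_ndivlMr// ler_ndivrMr//;
    by rewrite ![(c * x)%R]mulrC andbC.
rewrite /leb/= !lebesgue_measure_itv/= !lte_fin ltr0_norm//.
rewrite ltr_nM2r ?invr_lt0//; case: ifPn => _; last by rewrite mule0.
by rewrite -!EFinB -EFinM; congr EFin; field.
Qed.

Lemma ge0_integral_scale (R : realType) (c : R) (f : R -> \bar R) : c != 0%R ->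
  measurable_fun setT (f : measurableTypeR R -> \bar R) -> (forall x, 0 <= f x) ->
  \int[@leb R]_x f x = `|c|%:E * \int[@leb R]_x f (c * x)%R.
Proof.
move=> c0 mf f0; have ac : (0 < `|c|)%R by rewrite normr_gt0.
have mc : measurable_fun setT
    (fun x : measurableTypeR R => c * x : measurableTypeR R)%R.
  exact: mulrl_measurable.
have := @ge0_integral_pushforward _ _ _ _ R _ mc (@leb R) setT f measurableT mf
  (fun y _ => f0 y).
rewrite preimage_setT /comp => <-.
have mcp : forall k : {nonneg R}, \int[mscale k (@leb R)]_x f x = k%:num%:E * \int[@leb R]_x f x.
  by move=> k; rewrite ge0_integral_mscale.
have ai : (0 <= `|c|^-1)%R by rewrite invr_ge0 ltW.
transitivity (`|c|%:E * \int[mscale (NngNum ai) (@leb R)]_x f x).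
  by rewrite mcp/= muleA -EFinM divff ?gt_eqF// mul1e.
congr (_ * _); apply: eq_measure_integral => A mA _.
by have /= := lebesgue_measure_scale c0 mA; rewrite /pushforward /mscale/= => ->.
Qed.

End IntegralTools.

Notation plane R := (measurableTypeR R * measurableTypeR R)%type.

Section Polar.
Local Open Scope ereal_scope.
Variable R : realType.

Definition slope_dir (t : R) : R * R :=
  let c := (Num.sqrt (1 + t ^+ 2))^-1%R in (c, c * t)%R.

Lemma sqrD1_gt0 (t : R) : (0 < 1 + t ^+ 2)%R.
Proof. by rewrite ltr_wpDr// sqr_ge0. Qed.

Lemma slope_gt0 (t : R) : (0 < (Num.sqrt (1 + t ^+ 2))^-1)%R.
Proof. by rewrite invr_gt0 sqrtr_gt0 sqrD1_gt0. Qed.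

Lemma slope_sqr (t : R) :
  ((1 + t ^+ 2)^-1 = (Num.sqrt (1 + t ^+ 2))^-1 * (Num.sqrt (1 + t ^+ 2))^-1)%R.
Proof. by rewrite -invfM -expr2 sqr_sqrtr// ltW// sqrD1_gt0. Qed.

Lemma slope_dir_norm (t : R) : ((slope_dir t).1 ^+ 2 + (slope_dir t).2 ^+ 2 = 1)%R.
Proof.
rewrite /slope_dir/= exprMn -[X in (X + _)%R]mulr1 -mulrDr exprVn.
have t2 : (0 < 1 + t ^+ 2 :> R)%R by rewrite ltr_wpDr// sqr_ge0.
by rewrite sqr_sqrtr ?ltW// mulVf// gt_eqF.
Qed.

Lemma eq_integral_neq (f g : measurableTypeR R -> \bar R) (a : R) :
  measurable_fun setT f -> measurable_fun setT g ->
  (forall x, x != a -> f x = g x) -> \int[@leb R]_x f x = \int[@leb R]_x g x.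
Proof.
move=> mf mg fg.
have mD : measurable ([set: measurableTypeR R] `\ a) by apply: measurableD.
have h (k : measurableTypeR R -> \bar R) : measurable_fun setT k ->
    \int[@leb R]_x k x = \int[@leb R]_(x in setT `\ a) k x.
  by move=> mk; have := @integral_setD1 R k a setT mD (measurable_funTS mk).
rewrite (h f mf) (h g mg); apply: eq_integral => x; rewrite inE => -[_ /= /eqP].
exact: fg.
Qed.

Lemma integral_slope (F : plane R -> \bar R) :
  measurable_fun setT F -> (forall z, 0 <= F z) -> forall t : R,
  \int[@leb R]_x (`|x|%:E * F (x, x * t)%R) = ((1 + t ^+ 2)^-1)%:E *
    \int[@leb R]_r (`|r|%:E * F (r * (slope_dir t).1, r * (slope_dir t).2)%R).
Proof.
move=> mF F0 t.
have c0 := slope_gt0 t; have cE := slope_sqr t.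
have cn0 := lt0r_neq0 c0; have cN := gtr0_norm c0.
rewrite /slope_dir/= cE; move: c0 cn0 cN; set c := (Num.sqrt _)^-1%R => c0 cn0 cN.
pose G (x : measurableTypeR R) : \bar R := `|x|%:E * F (x, x * t)%R.
have mg (a b : R) : measurable_fun setT (fun r : measurableTypeR R =>
    `|r|%:E * F (r * a, r * b)%R).
  apply: emeasurable_funM; first by apply/measurable_EFinP; exact: normr_measurable.
  have h : measurable_fun setT (fun r : measurableTypeR R => (r * a, r * b)%R : plane R).
    by apply: measurable_fun_pair; exact: mulrr_measurable.
  exact: (measurableT_comp mF h).
have mG : measurable_fun setT G.
  have := mg 1%R t; congr (measurable_fun _ _).
  by apply/funext => x; rewrite /G mulr1.
have G0 x : 0 <= G x by apply: mule_ge0; [rewrite lee_fin; exact: normr_ge0|exact: F0].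
etransitivity; first exact: (ge0_integral_scale cn0 mG G0).
rewrite cN EFinM -muleA; congr (_ * _).
etransitivity; last first.
  apply: ge0_integralZl; [exact: measurableT|exact: mg| |rewrite lee_fin; exact: ltW].
  by move=> x _; apply: mule_ge0; [rewrite lee_fin; exact: normr_ge0|exact: F0].
apply: eq_integral => r _; rewrite /G normrM cN EFinM -muleA.
by rewrite (mulrC c r) mulrA.
Qed.

Lemma integral_polar_slope (F : plane R -> \bar R) :
  measurable_fun setT F -> (forall z, 0 <= F z) ->
  \int[@leb R \x @leb R]_z F z =
  \int[@leb R]_t (((1 + t ^+ 2)^-1)%:E *
    \int[@leb R]_r (`|r|%:E * F (r * (slope_dir t).1, r * (slope_dir t).2)%R)).
Proof.
move=> mF F0.
pose G (z : plane R) : \bar R := `|z.1|%:E * F (z.1, z.1 * z.2)%R.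
have mG : measurable_fun setT G.
  apply: emeasurable_funM.
    by apply/measurable_EFinP; apply: measurableT_comp => //; exact: measurable_fst.
  apply: (measurableT_comp mF (g := fun z : plane R => (z.1, z.1 * z.2)%R : plane R)).
  apply/measurable_fun_pairP; split => /=.
    exact: measurable_fst.
  by apply: measurable_funM; [exact: measurable_fst|exact: measurable_snd].
have G0 z : 0 <= G z by apply: mule_ge0; [rewrite lee_fin; exact: normr_ge0|exact: F0].
etransitivity.
  exact: (@fubini_tonelli1 _ _ _ _ R (@lebesgue_measure R) (@lebesgue_measure R) F mF F0).
have step1 : \int[@leb R]_x fubini_F (@leb R) F x = \int[@leb R]_x \int[@leb R]_t G (x, t).
  apply: (@eq_integral_neq _ _ 0%R).
  - exact: (measurable_fun_fubini_tonelli_F (m2 := @lebesgue_measure R) F).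
  - exact: (measurable_fun_fubini_tonelli_F (m2 := @lebesgue_measure R) G).
  move=> x x0.
  have h : measurable_fun setT (fun y : measurableTypeR R => F (x, y)).
    exact: measurable_fun_pair2.
  etransitivity; first exact: (ge0_integral_scale x0 h (fun y => F0 (x, y))).
  rewrite /G/=; symmetry; apply: ge0_integralZl.
  - exact: measurableT.
  - have mg : measurable_fun setT (fun y : measurableTypeR R => (x, x * y)%R : plane R).
      by apply: measurable_fun_pair; [exact: measurable_cst|exact: mulrl_measurable].
    exact: (measurableT_comp mF mg).
  - by move=> y _; exact: F0.
  - by rewrite lee_fin; exact: normr_ge0.
have slope t := integral_slope mF F0 t.
have step2 := @fubini_tonelli _ _ _ _ R (@lebesgue_measure R) (@lebesgue_measure R) G mG G0.
etransitivity; first exact: step1.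
etransitivity; first exact: step2.
by apply: eq_integral => t _; exact: slope.
Qed.

End Polar.

(** * Dyadic levels of monotone functions *)

Section SegmentsAndLevels.
Local Open Scope ereal_scope.
Variable R : realType.
Implicit Types (S : set (measurableTypeR R)) (phi : R -> \bar R) (B : \bar R).

Lemma integral_le_segments S phi B (a0 b0 : R) :
  measurable S -> S `<=` [set` `[a0, b0]] ->
  measurable_fun setT (phi : measurableTypeR R -> \bar R) ->
  (forall x, 0 <= phi x) -> 0 <= B ->
  (forall t r, S t -> S r -> (t < r)%R ->
     \int[@leb R]_(s in S `&` `[t, r]) phi s <= B) ->
  \int[@leb R]_(s in S) phi s <= B.
Proof.
move=> mS Sab mphi phi0 B0 H.
have [->|/set0P S0] := eqVneq S set0; first by rewrite integral_set0.
have lS : has_lbound (S : set R).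
  by exists a0 => x /Sab /=; rewrite in_itv/= => /andP[].
have uS : has_ubound (S : set R).
  by exists b0 => x /Sab /=; rewrite in_itv/= => /andP[].
set a := inf (S : set R); set b := sup (S : set R).
pose e n : R := (n.+1%:R^-1)%R.
have e0 n : (0 < e n)%R by rewrite invr_gt0.
pose F n : set (measurableTypeR R) := S `&` `[(a + e n)%R, (b - e n)%R].
have eFU : \bigcup_n F n = (S `\ a) `\ b.
  apply/seteqP; split => [x [n _ [Sx /=]]|x [[Sx /= /eqP xa] /= /eqP xb]].
    rewrite in_itv/= => /andP[ax xb]; split; [split|] => //= xE; subst x.
      by move: ax; rewrite leNgt ltrDl e0.
    by move: xb; rewrite leNgt ltrBlDr ltrDl e0.
  have lax : (a < x)%R by rewrite lt_neqAle eq_sym xa ge_inf.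
  have lxb : (x < b)%R by rewrite lt_neqAle xb ub_le_sup.
  have d0 : (0 < Num.min (x - a) (b - x))%R by rewrite lt_min !subr_gt0 lax.
  have [n _ /(_ n (leqnn n)) hn] := near_infty_natSinv_lt (PosNum d0).
  exists n => //; split => //=; rewrite in_itv/=.
  by move: hn; rewrite /= lt_min -/(e n) => /andP[h1 h2]; apply/andP; split; lra.
have -> : \int[@leb R]_(s in S) phi s = \int[@leb R]_(s in \bigcup_n F n) phi s.
  rewrite eFU; symmetry; rewrite (@integral_setD1 R phi b) ?(@integral_setD1 R phi a)//.
  - by apply: measurableD.
  - exact: measurable_funTS.
  - by do 2 apply: measurableD => //.
  - exact: measurable_funTS.
have mF n : measurable (F n) by apply: measurableI => //; exact: measurable_itv.
have ndF : nondecreasing_seq F.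
  move=> m n mn; apply/subsetPset => x [Sx /=]; rewrite in_itv/= => /andP[h1 h2].
  split => //=; rewrite in_itv/=.
  have : (e n <= e m)%R by rewrite lef_pV2 ?posrE// ler_nat.
  by move=> h; apply/andP; split; lra.
have cF := @ge0_nondecreasing_set_cvg_integral _ _ _ F phi (@leb R) ndF mF
  (fun i => measurable_funTS (mphi : measurable_fun setT _)) (fun i x _ => phi0 x).
rewrite -(cvg_lim (@ereal_hausdorff R) cF); apply: lime_le.
  by apply/cvg_ex; eexists; exact: cF.
apply: nearW => n.
have [ab|ab] := leP (a + e n)%R (b - e n)%R; last first.
  rewrite (_ : F n = set0) ?integral_set0//.
  by rewrite -subset0 => x [_ /=]; rewrite in_itv/= => /andP[]; lra.
have [t St ta] := inf_adherent (e0 n) (conj S0 lS).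
have [r Sr rb] := sup_adherent (e0 n) (conj S0 uS).
have tr : (t < r)%R by rewrite -/a -/b in ta rb; lra.
apply: le_trans (H t r St Sr tr); apply: ge0_subset_integral => //.
- by apply: measurableI => //; exact: measurable_itv.
- exact: measurable_funTS.
- move=> x [Sx /=]; rewrite in_itv/= => /andP[h1 h2]; split => //=.
  by rewrite in_itv/=; apply/andP; split; rewrite -/a -/b in ta rb; lra.
Qed.

Definition level (L : R -> R) (c : R) (k : nat) : set (measurableTypeR R) :=
  [set s | c / 2 ^+ k.+1 < L s <= c / 2 ^+ k]%R.

Lemma measurable_level S (L : R -> R) c k : measurable S ->
  measurable_fun S (L : measurableTypeR R -> measurableTypeR R) ->
  measurable (S `&` level L c k).
Proof.
move=> mS mL.
have -> : level L c k = L @^-1` `](c / 2 ^+ k.+1)%R, (c / 2 ^+ k)%R].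
  by apply/seteqP; split => x /=; rewrite in_itv.
by apply: mL => //; exact: measurable_itv.
Qed.

Lemma trivIset_level S (L : R -> R) (c : R) : (0 <= c)%R ->
  trivIset setT (fun k => S `&` level L c k).
Proof.
move=> c0; suff H i j (x : R) : level L c i x -> level L c j x -> ~ (i < j)%N.
  apply/trivIsetP => i j _ _; rewrite neq_ltn => ij.
  rewrite -subset0 => x [[_ xi] [_ xj]].
  by case/orP: ij => ij; [exact: (H _ _ _ xi xj ij)|exact: (H _ _ _ xj xi ij)].
move=> /andP[h1 _] /andP[_ h2] ij; have := lt_le_trans h1 h2.
by rewrite ltNge ler_wpM2l// lef_pV2 ?posrE ?exprn_gt0// ler_weXn2l// ler1n.
Qed.

Lemma bigcup_level S (L : R -> R) (c : R) :
  (forall s, S s -> 0 < L s <= c)%R -> \bigcup_k (S `&` level L c k) = S.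
Proof.
move=> H; apply/seteqP; split => [x [k _ [] //]|x Sx].
have /andP[L0 Lc] := H x Sx.
have c0 : (0 < c)%R by exact: lt_le_trans Lc.
have ex : exists k, (c / 2 ^+ k.+1 < L x)%R.
  exists (Num.bound (c / L x)); rewrite ltr_pdivrMr ?exprn_gt0//.
  rewrite mulrC -ltr_pdivrMr//; apply: lt_trans (archi_boundP _) _.
    by rewrite divr_ge0 ?ltW.
  rewrite -natrX ltr_nat; apply: ltn_trans (ltn_expl _ (isT : 1 < 2)%N) _.
  by rewrite ltn_exp2l.
exists (ex_minn ex) => //; split => //; case: ex_minnP => k hk mk.
rewrite /level/= hk/=; case: k hk mk => [|k] hk mk; first by rewrite expr0 divr1.
by rewrite leNgt; apply/negP => /mk; rewrite ltnn.
Qed.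

Lemma integral_levels S phi (L : R -> R) (c : R) (b : nat -> \bar R) :
  measurable S ->
  measurable_fun S (L : measurableTypeR R -> measurableTypeR R) ->
  (0 <= c)%R -> (forall s, S s -> 0 < L s <= c)%R ->
  measurable_fun S (phi : measurableTypeR R -> \bar R) ->
  (forall x, 0 <= phi x) ->
  (forall k, \int[@leb R]_(s in S `&` level L c k) phi s <= b k) ->
  \int[@leb R]_(s in S) phi s <= \sum_(k <oo) b k.
Proof.
move=> mS mL c0 H mphi phi0 Hb; rewrite -{1}(bigcup_level H) ge0_integral_bigcup//.
- apply: lee_nneseries => //.
  + by move=> k _ _; exact: integral_ge0.
- by move=> k; exact: measurable_level.
- by rewrite bigcup_level.
- exact: trivIset_level.
Qed.

Lemma nneseries_geometric_le (a x : R) : (0 <= a)%R -> (0 <= x < 1)%R ->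
  \sum_(k <oo) (a * x ^+ k)%:E <= (a / (1 - x))%:E.
Proof.
move=> a0 /andP[x0 x1]; apply: lime_le.
  by apply: is_cvg_nneseries => n _ _; rewrite lee_fin mulr_ge0// exprn_ge0.
apply: nearW => n; rewrite sumEFin lee_fin.
have x1' : (0 < 1 - x)%R by rewrite subr_gt0.
rewrite ler_pdivlMr// -mulr_sumr -mulrA ler_piMr//.
have := subrX1 x n; have := exprn_ge0 n x0; rewrite big_mkord.
by set s := (\sum_(i < n) x ^+ i)%R; set y := (x ^+ n)%R => y0 xy; lra.
Qed.

End SegmentsAndLevels.

Lemma powR2N_lt1 (R : realType) (x : R) : 0 < x -> 0 <= 2 `^ (- x) < 1.
Proof.
move=> x0; rewrite powR_ge0/= powRN invf_lt1 ?powR_gt0//.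
have := @gt0_ltr_powR R x x0 1 2; rewrite powR1; apply; rewrite ?nnegrE//.
by rewrite ltr1n.
Qed.

Lemma powR_exprn (R : realType) (b x : R) (k : nat) : 0 <= b ->
  (b ^+ k) `^ x = (b `^ x) ^+ k.
Proof.
by move=> b0; rewrite -(powR_mulrn k b0) -powRrM mulrC powRrM powR_mulrn// powR_ge0.
Qed.

Lemma powRVn (R : realType) (b x : R) (k : nat) : 0 < b ->
  (b ^+ k)^-1 `^ x = (b `^ (- x)) ^+ k.
Proof.
move=> b0; rewrite -powR_exprn ?ltW// powRN -powR_inv1 ?exprn_ge0 ?ltW//.
by rewrite -powRrM mulN1r powRN.
Qed.

Section TailBounds.
Local Open Scope ereal_scope.
Variables (R : realType) (phi : R -> \bar R) (Om : R -> R) (p eps : R).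
Hypothesis mphi : measurable_fun setT (phi : measurableTypeR R -> \bar R).
Hypothesis phi0 : forall x, 0 <= phi x.
Hypotheses (p0 : (0 < p)%R) (eps0 : (0 < eps)%R).

Lemma weighted_integral_bound (r B : R) : (0 < r)%R -> (0 <= B)%R ->
  (forall s : R, 0 < s <= r -> 0 < Om s)%R ->
  (forall s s' : R, 0 < s -> s <= s' -> s' <= r -> Om s' <= Om s)%R ->
  measurable_fun (`]0%R, r] : set (measurableTypeR R)) (Om : measurableTypeR R -> measurableTypeR R) ->
  (forall t : R, (0 < t < r)%R -> \int[@leb R]_(s in `[t, r]) phi s <= (B * Om t `^ p)%:E) ->
  \int[@leb R]_(s in `]0%R, r]) (phi s * (Om s `^ (- (p + eps)))%:E) <=
  (B * 2 `^ p / (1 - 2 `^ (- eps)) * Om r `^ (- eps))%:E.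
Proof.
move=> r0 B0 Om0 Omle mOm H.
have Omr : (0 < Om r)%R by apply: Om0; rewrite r0/=.
set w := Om r; set x0 : R := (2 `^ (- eps))%R.
have x01 : (0 <= x0 < 1)%R := powR2N_lt1 eps0.
set a := (B * 2 `^ p * w `^ (- eps))%R.
have a0 : (0 <= a)%R by rewrite !mulr_ge0// powR_ge0.
pose S : set (measurableTypeR R) := `]0%R, r]%classic.
have mS : measurable S by exact: measurable_itv.
have mpsi : measurable_fun S (fun s : measurableTypeR R => phi s * (Om s `^ (- (p + eps)))%:E).
  apply: emeasurable_funM; first exact: measurable_funTS.
  apply/measurable_EFinP; exact: (measurableT_comp (@measurable_powR R (- (p + eps))) mOm).
have mL : measurable_fun S (fun s : measurableTypeR R => (Om s)^-1 : measurableTypeR R)%R.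
  have := @measurableT_comp _ _ _ _ _ _ _ _ _ (@measurable_powR R (-1)) mOm.
  apply: eq_measurable_fun => s; rewrite inE /S/= in_itv/= => /andP[s0 sr].
  by rewrite powR_inv1// ltW// Om0// s0.
have mlev k : measurable (S `&` level (fun s => (Om s)^-1)%R w^-1%R k).
  exact: measurable_level.
apply: (@le_trans _ _ (\sum_(k <oo) (a * x0 ^+ k)%:E)); last first.
  apply: le_trans (nneseries_geometric_le a0 x01) _.
  by rewrite lee_fin /a -!mulrA [(w `^ _ * _)%R]mulrC.
apply: (@integral_levels _ S _ (fun s => (Om s)^-1)%R w^-1%R) => //.
- by rewrite invr_ge0 ltW.
- move=> s /=; rewrite /S/= in_itv/= => /andP[s0 sr].
  have Os : (0 < Om s)%R by apply: Om0; rewrite s0.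
  by rewrite invr_gt0 Os lef_pV2 ?posrE//= Omle.
- by move=> s; rewrite mule_ge0// lee_fin powR_ge0.
move=> k; set u := (2 ^+ k * w)%R.
have u0 : (0 < u)%R by rewrite mulr_gt0// exprn_gt0.
have lev s : (S `&` level (fun s => (Om s)^-1)%R w^-1%R k) s ->
    [/\ (0 < s <= r)%R, (u <= Om s)%R & (Om s < 2 * u)%R].
  move=> [/=]; rewrite /S/= in_itv/= => /andP[s0 sr] /andP[h1 h2].
  have Os : (0 < Om s)%R by apply: Om0; rewrite s0.
  rewrite s0 sr; split => //.
    by move: h2; rewrite -invfM lef_pV2 ?posrE// /u mulrC// mulr_gt0// exprn_gt0.
  move: h1; rewrite -invfM ltf_pV2 ?posrE ?mulr_gt0 ?exprn_gt0//.
  by rewrite exprS /u mulrC mulrA.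
have Hphi : \int[@leb R]_(s in S `&` level (fun s => (Om s)^-1)%R w^-1%R k) phi s
    <= (B * (2 * u) `^ p)%:E.
  apply: (@integral_le_segments _ _ _ _ 0%R r) => //.
  - by move=> s /lev[/andP[s0 sr] _ _] /=; rewrite in_itv/= sr ltW.
  - by rewrite lee_fin mulr_ge0// powR_ge0.
  move=> t r' /lev[/andP[t0 tr] ut tu] /lev[/andP[r'0 r'r] _ _] tr'.
  apply: (@le_trans _ _ (\int[@leb R]_(s in `[t, r]) phi s)).
    apply: ge0_subset_integral => //.
    - by apply: measurableI => //; exact: measurable_itv.
    - exact: measurable_funTS.
    - move=> s [_ /=]; rewrite !in_itv/= => /andP[-> sr'].
      exact: le_trans sr' r'r.
  apply: le_trans (H t _) _; first by rewrite t0 (lt_le_trans tr').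
  rewrite lee_fin ler_wpM2l// ge0_ler_powR ?nnegrE ?(ltW p0)//.
  - exact: le_trans (ltW u0) ut.
  - by rewrite mulr_ge0// ltW.
  - exact: ltW.
apply: (@le_trans _ _ (\int[@leb R]_(s in S `&` level (fun s => (Om s)^-1)%R w^-1%R k)
   (phi s * (u `^ (- (p + eps)))%:E))).
  apply: ge0_le_integral_nonmeasurable => s /lev[_ us _].
    by rewrite mule_ge0// lee_fin powR_ge0.
  have Os := lt_le_trans u0 us.
  rewrite lee_wpmul2l// lee_fin !powRN lef_pV2 ?posrE ?powR_gt0//.
  apply: ge0_ler_powR; rewrite ?nnegrE ?(ltW u0) ?(ltW Os)//.
  by rewrite addr_ge0 ?(ltW p0) ?(ltW eps0).
rewrite ge0_integralZr//; last 2 first.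
- exact: measurable_funTS.
- by rewrite lee_fin powR_ge0.
apply: le_trans (lee_wpmul2r _ Hphi) _; first by rewrite lee_fin powR_ge0.
rewrite -EFinM lee_fin.
have -> // : (B * (2 * u) `^ p * u `^ (- (p + eps)) = a * x0 ^+ k)%R.
rewrite powRM ?(ltW u0)// opprD powRD; last by rewrite (gt_eqF u0) implybT.
rewrite [(u `^ - p)%R]powRN.
have -> : (u `^ (- eps) = x0 ^+ k * w `^ (- eps))%R.
  by rewrite /u powRM ?exprn_ge0 ?(ltW Omr)// powR_exprn.
have up : (u `^ p != 0)%R by rewrite gt_eqF// powR_gt0.
by rewrite /a; field.
Qed.

Lemma segment_integral_bound (t r B : R) : (t < r)%R -> (0 <= B)%R ->
  (forall s : R, t <= s <= r -> 0 < Om s)%R ->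
  (forall s s' : R, t <= s -> s <= s' -> s' <= r -> Om s' <= Om s)%R ->
  measurable_fun (`[t, r] : set (measurableTypeR R)) (Om : measurableTypeR R -> measurableTypeR R) ->
  (forall t' r' : R, (t <= t')%R -> (t' < r')%R -> (r' <= r)%R ->
    \int[@leb R]_(s in `[t', r']) phi s <= (B * (Om t' / Om r') `^ eps * Om t' `^ p)%:E) ->
  \int[@leb R]_(s in `[t, r]) phi s <=
  (B * 2 `^ eps / (1 - 2 `^ (- p)) * Om t `^ p)%:E.
Proof.
move=> tr B0 Om0 Omle mOm H.
have Omt : (0 < Om t)%R by apply: Om0; rewrite lexx ltW.
set c := Om t; set x0 : R := (2 `^ (- p))%R.
have x01 : (0 <= x0 < 1)%R := powR2N_lt1 p0.
set a := (B * 2 `^ eps * c `^ p)%R.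
have a0 : (0 <= a)%R by rewrite !mulr_ge0// powR_ge0.
pose S : set (measurableTypeR R) := `[t, r]%classic.
have mS : measurable S by exact: measurable_itv.
apply: (@le_trans _ _ (\sum_(k <oo) (a * x0 ^+ k)%:E)); last first.
  apply: le_trans (nneseries_geometric_le a0 x01) _.
  by rewrite lee_fin /a -!mulrA [(c `^ _ * _)%R]mulrC.
apply: (@integral_levels _ S _ Om c) => //.
- exact: ltW.
- move=> s /=; rewrite /S/= in_itv/= => /andP[ts sr].
  by rewrite Om0 ?ts//= Omle.
- exact: measurable_funTS.
move=> k; set u := (c / 2 ^+ k)%R.
have u0 : (0 < u)%R by rewrite divr_gt0// exprn_gt0.
have -> : (a * x0 ^+ k = B * 2 `^ eps * u `^ p)%R.
  rewrite /a -mulrA; congr (_ * _)%R.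
  by rewrite /u powRM ?invr_ge0 ?exprn_ge0 ?(ltW Omt)// powRVn.
have lev s : (S `&` level Om c k) s ->
    [/\ (t <= s <= r)%R, (u / 2 < Om s)%R & (Om s <= u)%R].
  move=> [/=]; rewrite /S/= in_itv/= => -> /andP[h1 h2]; split => //.
  by move: h1; rewrite exprSr invfM mulrA.
apply: (@integral_le_segments _ _ _ _ t r) => //.
- by apply: measurable_level.
- by rewrite lee_fin; apply: mulr_ge0; [apply: mulr_ge0|]; rewrite ?powR_ge0.
move=> t' r' /lev[/andP[tt' t'r] ut tu] /lev[/andP[tr' r'r] ur ru] t'r'.
apply: (@le_trans _ _ (\int[@leb R]_(s in `[t', r']) phi s)).
  apply: ge0_subset_integral => //.
  - by apply: measurableI; [exact: measurable_level|exact: measurable_itv].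
  - exact: measurable_funTS.
apply: le_trans (H t' r' tt' t'r' r'r) _.
have Ot : (0 < Om t')%R by apply: Om0; rewrite tt'.
have Or : (0 < Om r')%R by apply: Om0; rewrite tr'.
have OO : (0 <= Om t' / Om r')%R by rewrite divr_ge0 ?(ltW Ot) ?(ltW Or).
have h1 : ((Om t' / Om r') `^ eps <= 2 `^ eps)%R.
  apply: ge0_ler_powR; rewrite ?nnegrE ?(ltW eps0)//.
  by rewrite ler_pdivrMr//; lra.
have h2 : (Om t' `^ p <= u `^ p)%R.
  by apply: ge0_ler_powR; rewrite ?nnegrE ?(ltW p0) ?(ltW Ot) ?(ltW u0).
rewrite lee_fin; apply: ler_pM; rewrite ?powR_ge0//.
  by rewrite mulr_ge0 ?powR_ge0.
exact: ler_wpM2l.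
Qed.

End TailBounds.

(** * The weak-type inequality on a ray *)

Section WeakType.
Local Open Scope ereal_scope.
Variable R : realType.

Lemma nonincreasing_on_emeasurable (D : set (measurableTypeR R)) (f : R -> \bar R) :
  is_interval (D : set R) ->
  (forall s s' : R, D s -> D s' -> (s <= s')%R -> f s' <= f s) ->
  measurable_fun D (f : measurableTypeR R -> \bar R).
Proof.
move=> iD Hf mD; have := @measurability _ _ _ _ D (f : measurableTypeR R -> \bar R) _
  (ErealGenCInfty.measurableE R).
apply => //; move=> _ [_ [r ->] <-].
apply: is_interval_measurable => s t /= [Ds fs] [Dt ft] u /andP[su ut].
have Du : D u by apply: (iD s t) => //; rewrite su.
split => //; move: fs ft; rewrite /= !in_itv/= !andbT => fs ft.
exact: le_trans ft (Hf _ _ Du Dt ut).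
Qed.

Variables (phi al ga : R -> \bar R) (Om : R -> R) (p N lam : R).
Hypothesis mphi : measurable_fun setT (phi : measurableTypeR R -> \bar R).
Hypothesis mal : measurable_fun setT (al : measurableTypeR R -> \bar R).
Hypothesis mga : measurable_fun setT (ga : measurableTypeR R -> \bar R).
Hypothesis phi0 : forall x, 0 <= phi x.
Hypothesis al0 : forall x, 0 <= al x.
Hypothesis ga0 : forall x, 0 <= ga x.
Hypotheses (p0 : (0 < p)%R) (N0 : (0 < N)%R) (lam0 : (0 < lam)%R).
Hypothesis Om0 : (forall s : R, 0 < s < 1 -> 0 < Om s)%R.
Hypothesis Omle : (forall s s' : R, 0 < s -> s <= s' -> s' < 1 -> Om s' <= Om s)%R.

Definition tail_int (g : R -> \bar R) (r : R) : \bar R := \int[@leb R]_(s in `[r, 1%R[) g s.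

Hypothesis key : forall (t r : R) (S : set (measurableTypeR R)),
  (0 < t)%R -> (t < r)%R -> (r < 1)%R -> measurable S -> S `<=` [set` `[r, 1%R[] ->
  (\int[@leb R]_(s in S) ga s) `^ p * \int[@leb R]_(s in `[t, r]) phi s <=
  ((N * Om t) `^ p)%:E * \int[@leb R]_(s in S) al s.

Let G := tail_int ga.
Let D : set (measurableTypeR R) := `]0%R, 1%R[%classic.
Let A := \int[@leb R]_(s in D) al s.

Let mD : measurable D. Proof. exact: measurable_itv. Qed.

Let DP (s : R) : D s -> (0 < s)%R /\ (s < 1)%R.
Proof. by rewrite /D/= in_itv/= => /andP[]. Qed.

Lemma tail_int_le (g : R -> \bar R) : measurable_fun setT (g : measurableTypeR R -> \bar R) ->
  (forall x, 0 <= g x) ->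
  forall s s' : R, (s <= s')%R -> tail_int g s' <= tail_int g s.
Proof.
move=> mg g0 s s' ss'; apply: ge0_subset_integral => //.
- exact: measurable_funTS.
- by move=> x /=; rewrite !in_itv/= => /andP[sx ->]; rewrite (le_trans ss').
Qed.

Let Gle := tail_int_le mga ga0.

Let G0 s : 0 <= G s. Proof. exact: integral_ge0. Qed.

Let mG : measurable_fun D (G : measurableTypeR R -> \bar R).
Proof.
apply: nonincreasing_on_emeasurable; first exact: interval_is_interval.
by move=> s s' _ _; exact: Gle.
Qed.

Let seg_sub (S : set (measurableTypeR R)) (t r : R) : measurable S ->
  \int[@leb R]_(s in S `&` `[t, r]) phi s <= \int[@leb R]_(s in `[t, r]) phi s.
Proof.
move=> mS; apply: ge0_subset_integral.
- by apply: measurableI => //; exact: measurable_itv.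
- exact: measurable_itv.
- exact: measurable_funTS.
- by move=> x _; exact: phi0.
- by move=> x [].
Qed.

Let Einf := D `&` [set s | G s = +oo].
Let Efin := D `&` [set s | (lam * Om s)%:E < G s /\ G s < +oo].

Let mEinf : measurable Einf.
Proof.
have := mG mD (emeasurable_set1 +oo).
by congr (measurable (_ `&` _)); apply/seteqP; split.
Qed.

Let L (s : R) : R := fine (G s).

Let mL : measurable_fun D (L : measurableTypeR R -> measurableTypeR R).
Proof. exact: (measurableT_comp (fine_measurable measurableT) mG). Qed.

Let GL s : G s < +oo -> G s = (L s)%:E.
Proof. by move=> Gs; rewrite /L fineK// ge0_fin_numE. Qed.

Let mEfin : measurable Efin.
Proof.
have mF : measurable (D `&` [set s | G s < +oo]).
  exact: emeasurable_fun_infty_o.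
have mO : measurable_fun D (fun s => lam * Om s : measurableTypeR R)%R.
  apply: measurable_funM => //.
  apply/measurable_EFinP; apply: nonincreasing_on_emeasurable.
    exact: interval_is_interval.
  by move=> s s' /DP[s0 _] /DP[_ s1] ss'; rewrite lee_fin; exact: Omle.
have mlt := measurable_fun_ltr mO mL.
have mtrue : measurable [set true] by [].
have := measurableI _ _ mF (mlt mD _ mtrue).
congr (measurable _); apply/seteqP; split => s /=.
  by move=> [[Ds Gs] [_ h]]; do 2 split => //; rewrite GL// lte_fin.
by move=> [Ds [h Gs]]; split; [by split|split => //; move: h; rewrite GL// lte_fin].
Qed.

Hypothesis Afin : A < +oo.

Let al_sub (S : set (measurableTypeR R)) : measurable S -> S `<=` D ->
  \int[@leb R]_(s in S) al s <= A.
Proof.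
move=> mS SD; apply: ge0_subset_integral => //; exact: measurable_funTS.
Qed.

Let int_Einf : \int[@leb R]_(s in Einf) phi s <= 0.
Proof.
apply: (@integral_le_segments _ _ _ _ 0%R 1%R) => //.
  by move=> s [/DP[s0 s1] _] /=; rewrite in_itv/= !ltW.
move=> t r [/DP[t0 t1] Gt] [/DP[r0 r1] Gr] tr.
apply: le_trans (seg_sub _ _ mEinf) _.
have mS : measurable (`[r, 1%R[%classic : set (measurableTypeR R)) by exact: measurable_itv.
have := key t0 tr r1 mS (fun _ => id).
rewrite -/(tail_int ga r) -/(G r) Gr poweRyr ?gt_eqF//.
have AS : \int[@leb R]_(s in `[r, 1%R[) al s <= A.
  by apply: al_sub => // s; rewrite /D/= !in_itv/= => /andP[rs ->]; rewrite (lt_le_trans r0).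
set H := \int[@leb R]_(s in `[t, r]) phi s.
have H0 : 0 <= H by exact: integral_ge0.
have [->//|Hn0] := eqVneq H 0.
rewrite gt0_mulye ?lt0e ?Hn0// leye_eq => /eqP /esym/eqP.
rewrite eq_sym -leye_eq leNgt => /negP[].
by rewrite lte_mul_pinfty// ?lee_fin ?powR_ge0// (le_lt_trans AS).
Qed.

Let tail_above (r a : R) : (0 < r < 1)%R -> (0 <= a)%R ->
  G r <= \int[@leb R]_(s in `[r, 1%R[ `&` [set s | a%:E < G s]) ga s + a%:E.
Proof.
move=> /andP[r0 r1] a0.
have rD : `[r, 1%R[%classic `<=` D.
  by move=> s; rewrite /D/= !in_itv/= => /andP[rs ->]; rewrite (lt_le_trans r0).
have mr : measurable (`[r, 1%R[%classic : set (measurableTypeR R)) by exact: measurable_itv.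
have mGr : measurable_fun `[r, 1%R[%classic (G : measurableTypeR R -> \bar R).
  exact: measurable_funS mG.
have m1 : measurable ((`[r, 1%R[ : set (measurableTypeR R)) `&` [set s | a%:E < G s]).
  exact: emeasurable_fun_o_infty.
have m2 : measurable ((`[r, 1%R[ : set (measurableTypeR R)) `&` [set s | G s <= a%:E]).
  exact: emeasurable_fun_infty_c.
have E : `[r, 1%R[%classic = (`[r, 1%R[ `&` [set s | a%:E < G s]) `|` (`[r, 1%R[ `&` [set s | G s <= a%:E]).
  rewrite -setIUr; apply/seteqP; split => [s rs|s []//]; split => //=.
  by have [h|h] := leP (G s) a%:E; [right|left].
have -> : G r = \int[@leb R]_(s in (`[r, 1%R[ `&` [set s | a%:E < G s]) `|` (`[r, 1%R[ `&` [set s | G s <= a%:E])) ga s.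
  by rewrite -E.
rewrite ge0_integral_setU//; last 2 first.
- exact: measurable_funTS.
- rewrite disj_set2E; apply/eqP; rewrite -subset0 => s [[_ /= h1] [_ /= h2]].
  by move: h1; rewrite ltNge h2.
rewrite leeD2l//; apply: (@integral_le_segments _ _ _ _ r 1%R) => //.
- by move=> s [] /=; rewrite !in_itv/= => /andP[-> s1] _; rewrite ltW.
move=> t1 r1' [rt1 Gt1] [rr1 Gr1] tr1; apply: le_trans Gt1.
apply: ge0_subset_integral => //.
- by apply: measurableI => //; exact: measurable_itv.
- exact: measurable_funTS.
- move=> s [[] /=]; rewrite !in_itv/= => /andP[_ ->] _ /andP[-> _] //.
Qed.

Let C : R := ((4 * N / lam) `^ p)%R.

Let level_bound (t r : R) (k : nat) : Efin t -> Efin r -> (t < r)%R ->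
  let c := L t in
  let W j := D `&` level L c j in
  \int[@leb R]_(s in Efin `&` `[t, r] `&` level L c k) phi s <=
  C%:E * (\int[@leb R]_(s in W k) al s + \int[@leb R]_(s in W k.+1) al s).
Proof.
move=> [Dt [lGt Gt]] [Dr [lGr Gr]] tr; set c := L t; set W := fun j => D `&` level L c j.
have [t0 t1] := DP Dt; have [r0 r1] := DP Dr.
have c0 : (0 < c)%R.
  by rewrite -lte_fin -GL//; apply: le_lt_trans lGt; rewrite lee_fin mulr_ge0 ?ltW ?Om0 ?t0.
have mW j : measurable (W j) by exact: measurable_level.
have W0 j : 0 <= \int[@leb R]_(s in W j) al s by exact: integral_ge0.
have mS : measurable (Efin `&` `[t, r] `&` level L c k).
  apply: measurable_level; first by apply: measurableI => //; exact: measurable_itv.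
  apply: measurable_funS mL => //; move=> s [[] //].
apply: (@integral_le_segments _ _ _ _ 0%R 1%R) => //.
- by move=> s [[[/DP[s0 s1] _] _] _] /=; rewrite in_itv/= !ltW.
- by apply: mule_ge0; [rewrite lee_fin powR_ge0|exact: (adde_ge0 (W0 k) (W0 k.+1))].
move=> t' r' [[[Dt' [lGt' Gt']] tt'r] lt'] [[[Dr' [lGr' Gr']] tr'r] lr'] t'r'.
have [t'0 t'1] := DP Dt'; have [r'0 r'1] := DP Dr'.
apply: le_trans (seg_sub _ _ mS) _.
set H := \int[@leb R]_(s in `[t', r']) phi s.
have H0 : 0 <= H by exact: integral_ge0.
pose a := (c / 2 ^+ k.+2)%R.
have a0 : (0 < a)%R by rewrite divr_gt0// exprn_gt0.
have a2 : (c / 2 ^+ k.+1 = 2 * a)%R by rewrite /a [(2 ^+ k.+2)%R]exprS; field; rewrite expf_neq0.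
have a4 : (c / 2 ^+ k = 4 * a)%R by rewrite /a !exprS; field; rewrite expf_neq0.
pose Sg : set (measurableTypeR R) := `[r', 1%R[ `&` [set s | a%:E < G s].
have r'D : `[r', 1%R[%classic `<=` D.
  by move=> s; rewrite /D/= !in_itv/= => /andP[rs ->]; rewrite (lt_le_trans r'0).
have mSg : measurable Sg.
  apply: emeasurable_fun_o_infty; first exact: measurable_itv.
  exact: measurable_funS mG.
have := key t'0 t'r' r'1 mSg (@subIsetl _ _ _).
rewrite -/H => K.
have Sga : a%:E <= \int[@leb R]_(s in Sg) ga s.
  have := @tail_above r' a; rewrite r'0 r'1 => /(_ isT (ltW a0)) h.
  have {}h : (2 * a)%:E <= \int[@leb R]_(s in Sg) ga s + a%:E.
    by apply: le_trans h; rewrite GL// lee_fin -a2 ltW//; case/andP: lr'.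
  by rewrite -(@leeD2rE _ a%:E)//; apply: le_trans h; rewrite -EFinD lee_fin; lra.
have SgW : \int[@leb R]_(s in Sg) al s <=
    \int[@leb R]_(s in W k) al s + \int[@leb R]_(s in W k.+1) al s.
  rewrite -ge0_integral_setU//; last 2 first.
  - exact: measurable_funTS.
  - have /trivIsetP := @trivIset_level _ D L _ (ltW c0); move=> /(_ k k.+1 I I).
    by rewrite disj_set2E neq_ltn ltnSn => /(_ isT)/eqP.
  apply: ge0_subset_integral => //; first exact: measurableU.
    exact: measurable_funTS.
  move=> s [/= rs as']; have Ds := r'D _ rs.
  have Gsr : G s <= G r' by apply: Gle; move: rs; rewrite in_itv/= => /andP[].
  have Gs : G s < +oo by exact: le_lt_trans Gsr Gr'.
  have Ls : (L s <= c / 2 ^+ k)%R.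
    have /andP[_ h] := lr'; apply: le_trans h; rewrite -lee_fin -!GL//.
  have aL : (a < L s)%R by rewrite -lte_fin -GL.
  by have [h|h] := leP (L s) (c / 2 ^+ k.+1)%R; [right|left]; split => //; apply/andP.
have K2 : (a `^ p)%:E * H <= ((N * Om t') `^ p)%:E * (\int[@leb R]_(s in W k) al s + \int[@leb R]_(s in W k.+1) al s).
  apply: le_trans (lee_wpmul2l _ SgW); last by rewrite lee_fin powR_ge0.
  apply: le_trans K; apply: lee_wpmul2r => //.
  rewrite -poweR_EFin; apply: gt0_ler_poweR; rewrite ?(ltW p0)//.
  - by rewrite in_itv/= leey lee_fin ltW.
  - by rewrite in_itv/= leey andbT; exact: integral_ge0.
have Om4 : (N * Om t' <= a * (4 * N / lam))%R.
  have h : (lam * Om t' <= 4 * a)%R.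
    rewrite -a4 -lee_fin; apply: (le_trans (ltW lGt')); rewrite GL// lee_fin.
    by case/andP: lt'.
  have -> : (a * (4 * N / lam) = N * (4 * a / lam))%R by field; rewrite gt_eqF.
  by rewrite ler_wpM2l ?(ltW N0)// ler_pdivlMr// mulrC.
have ap : (0 < a `^ p)%R by rewrite powR_gt0.
rewrite -(@lee_pmul2l _ (a `^ p)%:E)// ?lte_fin//.
apply: (le_trans K2); rewrite muleA -EFinM; apply: lee_wpmul2r; first exact: (adde_ge0 (W0 k) (W0 k.+1)).
rewrite lee_fin /C -powRM ?(ltW a0)//; last first.
  by rewrite divr_ge0 ?mulr_ge0 ?(ltW N0) ?(ltW lam0).
have NO : (0 <= N * Om t')%R by rewrite mulr_ge0 ?(ltW N0)// ltW// Om0// t'0.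
apply: ge0_ler_powR; rewrite ?nnegrE ?(ltW p0) ?(le_trans NO Om4)//.
Qed.

Let int_Efin : \int[@leb R]_(s in Efin) phi s <= (2 * C)%:E * A.
Proof.
have A0 : 0 <= A by exact: integral_ge0.
have C0 : (0 <= C)%R by exact: powR_ge0.
apply: (@integral_le_segments _ _ _ _ 0%R 1%R) => //.
- by move=> s [/DP[s0 s1] _] /=; rewrite in_itv/= !ltW.
- by apply: mule_ge0 => //; rewrite lee_fin mulr_ge0.
move=> t r Et Er tr.
have [Dt [lGt Gt]] := Et; have [t0 t1] := DP Dt.
pose W j := D `&` level L (L t) j.
have c0 : (0 < L t)%R.
  by rewrite -lte_fin -GL//; apply: le_lt_trans lGt; rewrite lee_fin mulr_ge0 ?ltW ?Om0 ?t0.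
have mW j : measurable (W j) by exact: measurable_level.
have W0 j : 0 <= \int[@leb R]_(s in W j) al s by exact: integral_ge0.
have mS : measurable (Efin `&` `[t, r]) by apply: measurableI => //; exact: measurable_itv.
apply: (@le_trans _ _ (\sum_(k <oo) (C%:E * (\int[@leb R]_(s in W k) al s + \int[@leb R]_(s in W k.+1) al s)))).
  apply: (@integral_levels _ _ _ L (L t)) => //.
  - apply: measurable_funS mL => //; move=> s [[] //].
  - exact: ltW.
  - move=> s [[Ds [lGs Gs]] /=]; rewrite in_itv/= => /andP[ts sr].
    have [s0 s1] := DP Ds.
    rewrite -lte_fin -lee_fin -!GL//; apply/andP; split; last exact: Gle.
    by apply: le_lt_trans lGs; rewrite lee_fin mulr_ge0 ?ltW ?Om0 ?s0.
  - exact: measurable_funTS.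
  - by move=> k; exact: level_bound.
rewrite nneseriesZl; last by move=> k _; exact: (adde_ge0 (W0 k) (W0 k.+1)).
rewrite nneseriesD//.
have s1 : \sum_(k <oo) \int[@leb R]_(s in W k) al s <= A.
  rewrite -ge0_integral_bigcup//.
  - apply: al_sub; first exact: bigcup_measurable.
    by move=> s [k _ []].
  - exact: measurable_funTS.
  - exact: (@trivIset_level _ D L _ (ltW c0)).
have s2 : \sum_(k <oo) \int[@leb R]_(s in W k.+1) al s <= A.
  rewrite -(@ge0_integral_bigcup _ _ _ _ (fun k => W k.+1))//.
  - apply: al_sub; first by apply: bigcup_measurable.
    by move=> s [k _ []].
  - exact: measurable_funTS.
  - have /trivIsetP h := @trivIset_level _ D L _ (ltW c0).
    by apply/trivIsetP => i j _ _ ij; apply: h.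
rewrite [(2 * C)%R]mulrC EFinM -muleA; apply: lee_wpmul2l; first by rewrite lee_fin.
by rewrite (mule_natl _ 2) mule2n; exact: leeD.
Qed.

Lemma weak_type_fin :
  (lam `^ p)%:E * \int[@leb R]_(s in D `&` [set s | (lam * Om s)%:E < G s]) phi s <=
  (2 * (4 * N) `^ p)%:E * A.
Proof.
have E : D `&` [set s | (lam * Om s)%:E < G s] = Einf `|` Efin.
  apply/seteqP; split => [s [Ds /= h]|s [[Ds /= h]|[Ds /= [h _]]]]; last 2 first.
  - by split => //=; rewrite h ltry.
  - by split.
  by have [g|g] := eqVneq (G s) +oo; [by left|right; split => //=; split => //; rewrite lt_neqAle g leey].
rewrite E ge0_integral_setU//; last 2 first.
- exact: measurable_funTS.
- rewrite disj_set2E; apply/eqP; rewrite -subset0 => s [[_ /= h1] [_ /= [_ h2]]].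
  by move: h2; rewrite h1 ltxx.
have h : \int[@leb R]_(s in Einf) phi s + \int[@leb R]_(s in Efin) phi s <= (2 * C)%:E * A.
  by rewrite -[leRHS]add0e; exact: leeD.
apply: le_trans (lee_wpmul2l _ h) _; first by rewrite lee_fin powR_ge0.
rewrite muleA -EFinM; apply: lee_wpmul2r; first exact: integral_ge0.
rewrite lee_fin mulrCA ler_wpM2l// /C -powRM ?(ltW lam0)//; last first.
  by rewrite divr_ge0 ?mulr_ge0 ?(ltW N0) ?(ltW lam0).
by rewrite mulrCA divff ?mulr1// gt_eqF.
Qed.

End WeakType.

Definition dual_value (R : realType) (q a b : R) : \bar R :=
  if b == 0 then (a%:E * +oo)%E else ((a / b) `^ q * b)%:E.

Section Hoelder.
Local Open Scope ereal_scope.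
Variables (R : realType) (p q : R).
Hypotheses (p1 : (1 < p)%R) (hpq : (p^-1 + q^-1 = 1)%R).

Lemma dual_value_ge0 (a b : R) : (0 <= a)%R -> (0 <= b)%R -> 0 <= dual_value q a b.
Proof.
move=> a0 b0; rewrite /dual_value; case: ifPn => _; first by rewrite mule_ge0// lee_fin.
by rewrite lee_fin mulr_ge0// powR_ge0.
Qed.

Lemma measurable_dual_value (a b : measurableTypeR R -> measurableTypeR R) :
  measurable_fun setT a -> measurable_fun setT b -> (forall s, 0 <= b s)%R ->
  measurable_fun setT (fun s => dual_value q (a s) (b s)).
Proof.
move=> ma mb b0; apply: measurable_fun_ifT.
- by apply: measurable_fun_eqr => //; exact: measurable_cst.
- by apply: emeasurable_funM => //; exact/measurable_EFinP.
- apply/measurable_EFinP; apply: measurable_funM => //.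
  have mV : measurable_fun setT (fun s => (b s)^-1 : measurableTypeR R)%R.
    have := measurableT_comp (@measurable_powR R (-1)) mb.
    by apply: eq_measurable_fun => s _; exact: powR_inv1.
  exact: (measurableT_comp (@measurable_powR R q) (measurable_funM ma mV)).
Qed.

Lemma conj_exponent : [/\ (0 < p)%R, (0 < q)%R, (1 < q)%R & (p / q = p - 1)%R].
Proof.
have p0 : (0 < p)%R by exact: lt_trans p1.
have qE : (q^-1 = 1 - p^-1)%R by rewrite -hpq; ring.
have q0 : (0 < q)%R by rewrite -invr_gt0 qE subr_gt0 invf_lt1.
split => //; last by rewrite qE; field; rewrite gt_eqF.
by rewrite -invf_lt1// qE ltrBlDr ltrDl invr_gt0.
Qed.

Lemma dual_value_gt0E (a b : R) : (0 <= a)%R -> (0 < b)%R ->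
  dual_value q a b = ((a * b `^ (- p^-1)) `^ q)%:E.
Proof.
move=> a0 b0; have [p0 q0 q1 pq] := conj_exponent.
have l : ((a / b) `^ q = a `^ q * b^-1 `^ q)%R by rewrite powRM// invr_ge0 ltW.
rewrite /dual_value gt_eqF// l powRM ?powR_ge0//.
congr EFin; rewrite -mulrA; congr (_ * _)%R.
rewrite -powR_inv1 ?(ltW b0)// -powRrM -[X in (_ * X)%R](powRr1 (ltW b0)) -powRrM.
rewrite -powRD; last by rewrite (gt_eqF b0) implybT.
congr (_ `^ _)%R; have -> : (p^-1 = 1 - q^-1)%R by rewrite -hpq; ring.
by field; rewrite gt_eqF.
Qed.

Lemma hoelder_dual (g a b : measurableTypeR R -> measurableTypeR R)
    (S : set (measurableTypeR R)) :
  measurable_fun setT g -> measurable_fun setT a -> measurable_fun setT b ->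
  (forall s, 0 <= g s)%R -> (forall s, 0 <= a s)%R -> (forall s, 0 <= b s)%R ->
  measurable S -> \int[@leb R]_(s in S) dual_value q (a s) (b s) < +oo ->
  (\int[@leb R]_(s in S) (g s * a s)%:E) `^ p <=
  \int[@leb R]_(s in S) (g s `^ p * b s)%:E *
  (\int[@leb R]_(s in S) dual_value q (a s) (b s)) `^ (p - 1).
Proof.
move=> mg ma mb g0 a0 b0 mS Dfin; have [p0 q0 q1 pq] := conj_exponent.
pose F1 : measurableTypeR R -> measurableTypeR R := (fun s => g s * b s `^ p^-1)%R.
pose F2 : measurableTypeR R -> measurableTypeR R :=
  (fun s => if b s == 0 then 0 else a s * b s `^ (- p^-1))%R.
have mF1 : measurable_fun setT F1.
  apply: measurable_funM => //; exact: (measurableT_comp (@measurable_powR R p^-1) mb).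
have mF2 : measurable_fun setT F2.
  apply: measurable_fun_ifT.
  - by apply: measurable_fun_eqr => //; exact: measurable_cst.
  - exact: measurable_cst.
  - apply: measurable_funM => //; exact: (measurableT_comp (@measurable_powR R (- p^-1)) mb).
have F10 s : (0 <= F1 s)%R by rewrite mulr_ge0// powR_ge0.
have F20 s : (0 <= F2 s)%R.
  by rewrite /F2; case: ifPn => // _; rewrite mulr_ge0// powR_ge0.
pose f1 : measurableTypeR R -> R := (F1 \_ S)%R; pose f2 : measurableTypeR R -> R := (F2 \_ S)%R.
have mf1 : measurable_fun setT f1.
  exact: (iffLR (measurable_restrictT F1 mS) (measurable_funTS mF1)).
have mf2 : measurable_fun setT f2.
  exact: (iffLR (measurable_restrictT F2 mS) (measurable_funTS mF2)).
have mD := measurable_dual_value ma mb b0.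
have D0 s := dual_value_ge0 (a0 s) (b0 s).
have Dae : {ae @leb R, forall s, S s -> dual_value q (a s) (b s) \is a fin_num}.
  apply: (integrable_ae mS); apply/integrableP; split; first exact: measurable_funTS.
  by under eq_integral do rewrite gee0_abs//.
have E1 : \int[@leb R]_(s in S) (g s * a s)%:E = \int[@leb R]_(s in S) (F1 s * F2 s)%:E.
  apply: ge0_ae_eq_integral => //.
  - by apply/measurable_EFinP; apply: measurable_funTS; exact: measurable_funM.
  - by apply/measurable_EFinP; apply: measurable_funTS; exact: measurable_funM.
  - by move=> s _; rewrite lee_fin mulr_ge0.
  - by move=> s _; rewrite lee_fin mulr_ge0.
  apply: filterS Dae => s H Ss; have := H Ss; rewrite /F1 /F2 /dual_value.
  have [bs0|bs0] := eqVneq (b s) 0%R.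
    have [as0|as0] := eqVneq (a s) 0%R; first by rewrite as0 !mulr0.
    by rewrite gt0_muley// lte_fin lt_neqAle eq_sym as0 a0.
  move=> _; congr EFin; have bs : (0 < b s)%R by rewrite lt_neqAle eq_sym bs0 b0.
  by rewrite powRN; field; rewrite gt_eqF// powR_gt0.
have H := @hoelder _ _ R (@leb R) f1 f2 p q mf1 mf2 p0 q0 hpq.
have N1 : 'N[@leb R]_1[EFin \o (f1 \* f2)%R] = \int[@leb R]_(s in S) (g s * a s)%:E.
  rewrite Lnorm1 E1 [RHS]integral_mkcond; apply: eq_integral => s _.
  rewrite /f1 /f2 /= !patchE; case: ifPn => _; last by rewrite mul0r normr0.
  by rewrite ger0_norm// mulr_ge0.
have Np : 'N[@leb R]_p%:E[EFin \o f1] `^ p = \int[@leb R]_(s in S) (g s `^ p * b s)%:E.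
  rewrite powR_Lnorm ?gt_eqF// [RHS]integral_mkcond; apply: eq_integral => s _.
  rewrite /f1 /= !patchE; case: ifPn => _; last by rewrite normr0 powR0 ?gt_eqF.
  rewrite ger0_norm// /F1 powRM ?powR_ge0// -powRrM mulVf ?gt_eqF// powRr1//.
have Nq : 'N[@leb R]_q%:E[EFin \o f2] `^ q <= \int[@leb R]_(s in S) dual_value q (a s) (b s).
  rewrite powR_Lnorm ?gt_eqF// [leRHS]integral_mkcond.
  apply: ge0_le_integral_nonmeasurable => s _; first by rewrite lee_fin powR_ge0.
  rewrite /f2 /= !patchE; case: ifPn => _; last by rewrite normr0 powR0 ?gt_eqF.
  rewrite ger0_norm// /F2; case: ifPn => bs0; first by rewrite powR0 ?gt_eqF//; exact: D0.
  by rewrite dual_value_gt0E// lt_neqAle eq_sym bs0 b0.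
rewrite -N1.
apply: (@le_trans _ _ (('N[@leb R]_p%:E[EFin \o f1] * 'N[@leb R]_q%:E[EFin \o f2]) `^ p)).
  apply: gt0_ler_poweR; rewrite ?(ltW p0)// in_itv/= leey andbT.
    exact: Lnorm_ge0.
  by apply: mule_ge0; exact: Lnorm_ge0.
rewrite poweRM ?Lnorm_ge0// Np; apply: lee_wpmul2l.
  by apply: integral_ge0 => s _; rewrite lee_fin mulr_ge0// powR_ge0.
have pE : p = (q * (p - 1))%R by rewrite -pq; field; rewrite gt_eqF.
have -> : 'N[@leb R]_q%:E[EFin \o f2] `^ p = ('N[@leb R]_q%:E[EFin \o f2] `^ q) `^ (p - 1).
  by rewrite -poweRrM -pE.
apply: gt0_ler_poweR; rewrite ?in_itv/= ?leey ?poweR_ge0//; first by rewrite subr_ge0 ltW.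
by rewrite andbT; exact: integral_ge0.
Qed.

End Hoelder.

Section WeightedWeakType.
Local Open Scope ereal_scope.
Variables (R : realType) (p q N lam : R).
Hypotheses (p1 : (1 < p)%R) (hpq : (p^-1 + q^-1 = 1)%R).
Hypotheses (N0 : (0 < N)%R) (lam0 : (0 < lam)%R).
Variables (f g a b : measurableTypeR R -> measurableTypeR R) (Om : R -> R).
Hypotheses (mf : measurable_fun setT f) (mg : measurable_fun setT g).
Hypotheses (ma : measurable_fun setT a) (mb : measurable_fun setT b).
Hypotheses (f0 : (forall s, 0 <= f s)%R) (g0 : (forall s, 0 <= g s)%R).
Hypotheses (a0 : (forall s, 0 <= a s)%R) (b0 : (forall s, 0 <= b s)%R).
Hypothesis Om0 : (forall s : R, 0 < s < 1 -> 0 < Om s)%R.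
Hypothesis Omle : (forall s s' : R, 0 < s -> s <= s' -> s' < 1 -> Om s' <= Om s)%R.
Let dual (s : R) := dual_value q (a s) (b s).
Hypothesis cond : forall t r : R, (0 < t)%R -> (t < r)%R -> (r < 1)%R ->
  \int[@leb R]_(s in `[t, r]) (f s)%:E * tail_int dual r `^ (p - 1) <= ((N * Om t) `^ p)%:E.

Lemma weak_type_weights :
  (lam `^ p)%:E * \int[@leb R]_(s in `]0%R, 1%R[%classic `&`
     [set s | (lam * Om s)%:E < tail_int (fun s => (g s * a s)%:E) s]) (f s)%:E <=
  (2 * (4 * N) `^ p)%:E * \int[@leb R]_(s in `]0%R, 1%R[) (g s `^ p * b s)%:E.
Proof.
have [p0 q0 q1 pq] := conj_exponent p1 hpq.
have mal : measurable_fun setT (fun s => (g s `^ p * b s)%:E).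
  apply/measurable_EFinP; apply: measurable_funM => //.
  exact: (measurableT_comp (@measurable_powR R p) mg).
have al0 s : 0 <= (g s `^ p * b s)%:E by rewrite lee_fin mulr_ge0// powR_ge0.
have [A|A] := ltP (\int[@leb R]_(s in `]0%R, 1%R[) (g s `^ p * b s)%:E) +oo; last first.
  move: A; rewrite leye_eq => /eqP ->; rewrite gt0_muley ?leey//.
  by rewrite lte_fin mulr_gt0// powR_gt0// mulr_gt0.
have d0 s : 0 <= dual s by exact: dual_value_ge0.
have md : measurable_fun setT (dual : measurableTypeR R -> \bar R).
  exact: measurable_dual_value.
apply: (@weak_type_fin R (EFin \o f) _ _ Om) => //.
- exact/measurable_EFinP.
- by apply/measurable_EFinP; exact: measurable_funM.
- by move=> s; rewrite lee_fin mulr_ge0.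
move=> t r S t0 tr r1 mS Sr; have := cond t0 tr r1.
set H := \int[@leb R]_(s in `[t, r]) _ => K.
have H0 : 0 <= H by apply: integral_ge0 => s _; rewrite lee_fin.
have D0 : 0 <= tail_int dual r by exact: integral_ge0.
have al0S : 0 <= \int[@leb R]_(s in S) (g s `^ p * b s)%:E by exact: integral_ge0.
have N00 : 0 <= ((N * Om t) `^ p)%:E by rewrite lee_fin powR_ge0.
have [Dr|Dr] := ltP (tail_int dual r) +oo; last first.
  have HE : H = 0.
    move: Dr; rewrite leye_eq => /eqP Dr; move: K; rewrite Dr poweRyr; last first.
      by rewrite gt_eqF// subr_gt0.
    have [//|Hn0] := eqVneq H 0; rewrite gt0_muley ?lt0e ?Hn0//.
  by rewrite HE mule0; exact: mule_ge0.
have DS : \int[@leb R]_(s in S) dual s <= tail_int dual r.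
  by apply: ge0_subset_integral => //; exact: measurable_funTS.
have := hoelder_dual p1 hpq mg ma mb g0 a0 b0 mS (le_lt_trans DS Dr).
move=> hold; apply: le_trans (lee_wpmul2r H0 hold) _.
rewrite -muleA muleC; apply: lee_wpmul2r => //.
apply: le_trans K; rewrite muleC; apply: lee_wpmul2l => //.
apply: gt0_ler_poweR; rewrite ?in_itv/= ?leey ?andbT//; first by rewrite subr_ge0 ltW.
by apply: integral_ge0 => s _; exact: d0.
Qed.

End WeightedWeakType.

(** * From rays to the disc *)

Section PlaneIntegrals.
Local Open Scope ereal_scope.
Variable R : realType.

Lemma integral_halves (f : R -> \bar R) :
  measurable_fun setT (f : measurableTypeR R -> \bar R) -> (forall x, 0 <= f x) ->
  \int[@leb R]_x f x =
  \int[@leb R]_(x in `]0%R, +oo[) f x + \int[@leb R]_(x in `]0%R, +oo[) f (- x)%R.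
Proof.
move=> mf f0.
have mP : measurable (`]0%R, +oo[%classic : set (measurableTypeR R)) by exact: measurable_itv.
have mNo : measurable (`]-oo, 0%R[%classic : set (measurableTypeR R)) by exact: measurable_itv.
have -> : \int[@leb R]_x f x = \int[@leb R]_(x in `]0%R, +oo[ `|` `]-oo, 0%R[) f x.
  transitivity (\int[@leb R]_(x in setT `\ 0%R) f x).
    by symmetry; apply: integral_setD1; [apply: measurableD|exact: measurable_funTS].
  congr (integral _ _ _); apply/seteqP; split => x /=.
    move=> [_ /eqP x0]; rewrite !in_itv/= andbT.
    by case: (ltgtP x 0%R) x0 => // h _; [right|left].
  by rewrite !in_itv/= andbT => -[h|h]; split => // xE; rewrite xE ltxx in h.
rewrite ge0_integral_setU//; last 2 first.
- exact: measurable_funTS.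
- rewrite disj_set2E; apply/eqP; rewrite -subset0 => x /=.
  by rewrite !in_itv/= andbT => -[h1 h2]; have := lt_trans h1 h2; rewrite ltxx.
congr (_ + _); rewrite [LHS]integral_mkcond [RHS]integral_mkcond.
have mfN : measurable_fun setT ((f \_ `]-oo, 0%R[) : measurableTypeR R -> \bar R).
  by apply/(measurable_restrictT f) => //; exact: measurable_funTS.
have n1 : (-1 != 0 :> R)%R by rewrite oppr_eq0 oner_eq0.
have fN0 x : 0 <= (f \_ `]-oo, 0%R[) x by apply: erestrict_ge0.
rewrite (ge0_integral_scale n1 mfN fN0) normrN1 mul1e.
apply: eq_integral => x _; rewrite !patchE mulN1r; congr (if _ then _ else _).
by apply/idP/idP; rewrite !inE/= !in_itv/= andbT oppr_lt0.
Qed.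

Definition ray_int (F : plane R -> \bar R) (u : R * R) : \bar R :=
  \int[@leb R]_(s in `]0%R, +oo[) (s%:E * F (s * u.1, s * u.2)%R).

Let polar_line (F : plane R -> \bar R) (u : R * R) : measurable_fun setT F ->
  (forall z, 0 <= F z) ->
  \int[@leb R]_r (`|r|%:E * F (r * u.1, r * u.2)%R) =
  ray_int F u + ray_int F (- u.1, - u.2)%R.
Proof.
move=> mF F0.
have mG : measurable_fun setT (fun r : measurableTypeR R => `|r|%:E * F (r * u.1, r * u.2)%R).
  apply: emeasurable_funM; first by apply/measurable_EFinP; exact: normr_measurable.
  have h : measurable_fun setT (fun r : measurableTypeR R => (r * u.1, r * u.2)%R : plane R).
    by apply: measurable_fun_pair; exact: mulrr_measurable.
  exact: (measurableT_comp mF h).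
rewrite integral_halves//; last by move=> r; apply: mule_ge0; [rewrite lee_fin; exact: normr_ge0|exact: F0].
congr (_ + _); apply: eq_integral => r; rewrite inE/= in_itv/= andbT => r0.
  by rewrite gtr0_norm.
by rewrite normrN gtr0_norm//= !mulrN !mulNr.
Qed.

Lemma le_integral_dA (F1 F2 : plane R -> \bar R) :
  measurable_fun setT F2 -> (forall z, 0 <= F1 z) -> (forall z, 0 <= F2 z) ->
  (forall u : R * R, (u.1 ^+ 2 + u.2 ^+ 2 = 1)%R -> ray_int F1 u <= ray_int F2 u) ->
  \int[@dA R]_z F1 z <= \int[@dA R]_z F2 z.
Proof.
move=> mF2 F10 F20 H; apply: ge0_le_integral_nnsfun => // h mh h0 hF.
have mh' : measurable_fun setT (EFin \o h) by exact/measurable_EFinP.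
have h0' z : 0 <= (h z)%:E by rewrite lee_fin; exact: h0.
rewrite /dA !ge0_integral_mscale//; apply: lee_wpmul2l; first by rewrite lee_fin.
rewrite (integral_polar_slope mh' h0') (integral_polar_slope mF2 F20).
have i0 t : (0 <= (1 + t ^+ 2)^-1 :> R)%R by rewrite invr_ge0 ltW// sqrD1_gt0.
have ray0 F u : (forall z, 0 <= F z) -> 0 <= ray_int F u.
  move=> F0; apply: integral_ge0 => s /=; rewrite in_itv/= andbT => s0.
  by apply: mule_ge0; [rewrite lee_fin ltW|exact: F0].
have leray u : (u.1 ^+ 2 + u.2 ^+ 2 = 1)%R -> ray_int (EFin \o h) u <= ray_int F2 u.
  move=> u1; apply: le_trans (H u u1).
  apply: ge0_le_integral_nonmeasurable => s /=; rewrite in_itv/= andbT => s0.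
    by apply: mule_ge0; [rewrite lee_fin ltW|exact: h0'].
  by apply: lee_wpmul2l; [rewrite lee_fin ltW|exact: hF].
apply: ge0_le_integral_nonmeasurable => t _; rewrite !polar_line//.
  by apply: mule_ge0; [rewrite lee_fin; exact: i0|apply: adde_ge0; exact: ray0].
apply: lee_wpmul2l; first by rewrite lee_fin; exact: i0.
have u1 := slope_dir_norm t.
by apply: leeD; apply: leray; rewrite //= ?sqrrN.
Qed.

Definition pnorm (z : R * R) : R := Num.sqrt (z.1 ^+ 2 + z.2 ^+ 2).

Lemma measurable_pnorm : measurable_fun setT (pnorm : plane R -> measurableTypeR R).
Proof.
have m : measurable_fun setT (fun z : plane R => z.1 ^+ 2 + z.2 ^+ 2 : measurableTypeR R)%R.
  by apply: measurable_funD; apply: measurable_funX; [exact: measurable_fst|exact: measurable_snd].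
have := measurableT_comp (@measurable_powR R 2^-1) m.
apply: eq_measurable_fun => z _; apply: powR12_sqrt.
by rewrite addr_ge0// sqr_ge0.
Qed.

Lemma pnorm_ray (u : R * R) (s : R) : (u.1 ^+ 2 + u.2 ^+ 2 = 1)%R -> (0 <= s)%R ->
  pnorm (s * u.1, s * u.2)%R = s.
Proof.
by move=> u1 s0; rewrite /pnorm/= !exprMn -mulrDr u1 mulr1 sqrtr_sqr ger0_norm.
Qed.

Lemma integral_oneDsqr : \int[@leb R]_t ((1 + t ^+ 2)^-1)%:E = (pi : R)%:E.
Proof.
have m : measurable_fun setT (fun t : measurableTypeR R => ((1 + t ^+ 2)^-1)%:E).
  apply/measurable_EFinP; apply: continuous_measurable_fun.
  by move=> t; exact: continuous_oneDsqrV.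
have t0 (t : R) : 0 <= ((1 + t ^+ 2)^-1)%:E by rewrite lee_fin invr_ge0 ltW// sqrD1_gt0.
rewrite integral_halves//; under [X in _ + X]eq_integral do rewrite sqrrN.
have -> : \int[@leb R]_(x in `]0%R, +oo[) ((1 + x ^+ 2)^-1)%:E = (pi / 2)%:E.
  rewrite -integral0y_oneDsqr; apply: integral_itv_obnd_cbnd; exact: measurable_funTS.
by rewrite -EFinD; congr EFin; field.
Qed.

Lemma integral_dA_radial (k : measurableTypeR R -> \bar R) : measurable_fun setT k ->
  (forall s, 0 <= k s) ->
  \int[@dA R]_z k (pnorm z) = 2%:E * \int[@leb R]_(s in `]0%R, +oo[) (s%:E * k s).
Proof.
move=> mk k0; set I := (X in _ = _ * X).
have I0 : 0 <= I.
  apply: integral_ge0 => s /=; rewrite in_itv/= andbT => s0.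
  by apply: mule_ge0; [rewrite lee_fin ltW|exact: k0].
have mF : measurable_fun setT (fun z : plane R => k (pnorm z)).
  exact: (measurableT_comp mk measurable_pnorm).
have F0 (z : plane R) : 0 <= k (pnorm z) by exact: k0.
have rayE u : (u.1 ^+ 2 + u.2 ^+ 2 = 1)%R -> ray_int (fun z => k (pnorm z)) u = I.
  move=> u1; apply: eq_integral => s; rewrite inE/= in_itv/= andbT => s0.
  by rewrite pnorm_ray// ltW.
rewrite /dA ge0_integral_mscale// (integral_polar_slope mF F0).
have i0 t : (0 <= (1 + t ^+ 2)^-1 :> R)%R by rewrite invr_ge0 ltW// sqrD1_gt0.
have -> : \int[@leb R]_t (((1 + t ^+ 2)^-1)%:E *
    \int[@leb R]_r (`|r|%:E * k (pnorm (r * (slope_dir t).1, r * (slope_dir t).2)%R))) =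
    \int[@leb R]_t (((1 + t ^+ 2)^-1)%:E * (I + I)).
  apply: eq_integral => t _; congr (_ * _).
  etransitivity; first exact: (polar_line (slope_dir t) mF F0).
  congr (_ + _).
    by rewrite rayE// slope_dir_norm.
  by rewrite rayE//= !sqrrN slope_dir_norm.
rewrite ge0_integralZr//; last 3 first.
- apply/measurable_EFinP; apply: continuous_measurable_fun.
  by move=> t; exact: continuous_oneDsqrV.
- by move=> t _; rewrite lee_fin; exact: i0.
- exact: adde_ge0.
rewrite integral_oneDsqr/= muleA -EFinM mulVf ?gt_eqF ?pi_gt0// mul1e.
by rewrite (mule_natl _ 2) mule2n.
Qed.

End PlaneIntegrals.

(* Cut off to [0] outside of ]0, 1[, so that it is measurable on the whole line
   although nothing is known about w outside of the disc. *)
Definition pw (R : realType) (w : R[i] -> R) (s : R) : R :=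
  if 0 < s < 1 then w s%:C%C else 0.

Section RadialParts.
Local Open Scope ereal_scope.
Variable R : realType.

Lemma modc_cpt (z : R * R) : modc (cpt z) = pnorm z.
Proof. by []. Qed.

Lemma ray_cpt (u : R * R) (s s' : R) : (u.1 ^+ 2 + u.2 ^+ 2 = 1)%R -> (0 < s)%R ->
  ray (cpt (s * u.1, s * u.2)%R) s' = cpt (s' * u.1, s' * u.2)%R.
Proof.
move=> u1 s0; rewrite /ray modc_cpt pnorm_ray ?ltW// /cpt/=.
have E (x : R) : ((x * u.1) +i* (x * u.2) = x%:C * (u.1 +i* u.2))%C%R.
  by apply/eqP; rewrite eq_complex /= !mul0r subr0 addr0 !eqxx.
rewrite !E; congr (_ * _)%R.
have s0' : (s%:C)%C != 0%R :> R[i] by apply/eqP => -[/eqP]; rewrite gt_eqF.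
by rewrite mulrAC divff// mul1r.
Qed.

Let Dd : set (plane R) := @cpt R @^-1` @disc R.

Lemma DdE z : Dd z = (pnorm z < 1)%R :> Prop.
Proof. by []. Qed.

Lemma measurable_disc : measurable Dd.
Proof.
have := measurable_pnorm measurableT (measurable_itv `]-oo, (1 : R)%R[).
by rewrite setTI; congr measurable.
Qed.

Lemma disc_ray (u : R * R) (s : R) : (u.1 ^+ 2 + u.2 ^+ 2 = 1)%R -> (0 < s < 1)%R ->
  Dd (s * u.1, s * u.2)%R.
Proof. by move=> u1 /andP[s0 s1]; rewrite DdE pnorm_ray// ltW. Qed.

Lemma measurable_ray (d : measure_display) (T : measurableType d) (F : plane R -> T) (u : R * R) (c : T) :
  (u.1 ^+ 2 + u.2 ^+ 2 = 1)%R -> measurable_fun Dd F ->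
  measurable_fun setT (fun s : measurableTypeR R =>
    if (0 < s < 1)%R then F (s * u.1, s * u.2)%R else c).
Proof.
move=> u1 mF.
have mI : measurable (`]0%R, 1%R[%classic : set (measurableTypeR R)) by exact: measurable_itv.
have mFI : measurable_fun (`]0%R, 1%R[%classic : set (measurableTypeR R))
    (F \o (fun s : measurableTypeR R => (s * u.1, s * u.2)%R : plane R)).
  apply: (@measurable_comp _ _ _ _ _ _ Dd) => //; first exact: measurable_disc.
    by move=> _ [s /= +] <-; rewrite in_itv/=; exact: disc_ray.
  by apply: measurable_funTS; apply: measurable_fun_pair; exact: mulrr_measurable.
rewrite -(setvU `]0%R, 1%R[%classic) setUC; apply/measurable_funU => //.
  exact: measurableC.
split.
- apply: (eq_measurable_fun _ _ mFI) => s.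
  by rewrite inE/= in_itv/= => ->.
- apply: (eq_measurable_fun _ _ (measurable_cst c)) => s.
  by rewrite inE/= in_itv/= => /negP/negbTE ->.
Qed.

Lemma eq_integral_unit (F G : R -> \bar R) (x y : R) (b0 b1 : bool) :
  measurable_fun setT (G : measurableTypeR R -> \bar R) ->
  (0 <= x)%R -> (y <= 1)%R -> (forall s : R, 0 < s < 1 -> F s = G s)%R ->
  \int[@leb R]_(s in [set` Interval (BSide b0 x) (BSide b1 y)]) F s =
  \int[@leb R]_(s in [set` Interval (BSide b0 x) (BSide b1 y)]) G s.
Proof.
move=> mG x0 y1 FG.
have E s : s \in `]x, y[%classic -> F s = G s.
  rewrite inE/= in_itv/= => /andP[xs sy]; apply: FG.
  by rewrite (le_lt_trans x0)//= (lt_le_trans sy).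
have mF : measurable_fun (`]x, y[%classic : set (measurableTypeR R)) (F : measurableTypeR R -> \bar R).
  by apply: (eq_measurable_fun (G : measurableTypeR R -> \bar R)); [move=> s /E|exact: measurable_funTS].
have mG' : measurable_fun (`]x, y[%classic : set (measurableTypeR R)) (G : measurableTypeR R -> \bar R).
  exact: measurable_funTS.
have EF := @integral_itv_bndoo R x y F b0 b1 mF.
have EG := @integral_itv_bndoo R x y G b0 b1 mG'.
by rewrite [LHS]EF [RHS]EG; exact: eq_integral.
Qed.

Section OneWeight.
Variable w : R[i] -> R.
Hypothesis ww : radial_weight w.

Lemma radial_cpt (z : R * R) : Dd z -> w (cpt z) = w (pnorm z)%:C%C.
Proof. by case: ww => _ + _ => /[apply]. Qed.

Lemma pw_ge0 s : (0 <= pw w s)%R.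
Proof.
rewrite /pw; case: ifPn => // s01; case: ww => -[+ _] _ _; apply.
have := @disc_ray (1, 0)%R s; rewrite /= mulr1 mulr0 => /(_ _ s01); apply.
by rewrite expr1n expr0n/= addr0.
Qed.

Lemma measurable_weight : measurable_fun Dd (fun z => w (cpt z) : measurableTypeR R).
Proof.
case: ww => -[_ iw] _ _; have := measurable_int _ iw.
by move=> /measurable_EFinP.
Qed.

Lemma measurable_pw : measurable_fun setT (pw w : measurableTypeR R -> measurableTypeR R).
Proof.
have u1 : (((1, 0) : R * R).1 ^+ 2 + ((1, 0) : R * R).2 ^+ 2 = 1)%R.
  by rewrite /= expr1n expr0n/= addr0.
have := @measurable_ray _ _ _ (1, 0)%R (0%R : measurableTypeR R) u1 measurable_weight.
by apply: eq_measurable_fun => s _; rewrite /pw /= /cpt/= mulr1 mulr0.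
Qed.

Lemma pw_cpt (u : R * R) (s : R) : (u.1 ^+ 2 + u.2 ^+ 2 = 1)%R -> (0 < s < 1)%R ->
  w (cpt (s * u.1, s * u.2)%R) = pw w s.
Proof.
move=> u1 s01; rewrite radial_cpt; last exact: disc_ray.
by rewrite pnorm_ray ?/pw ?s01// ltW//; case/andP: s01.
Qed.

Lemma integral_pw_lty : \int[@leb R]_(s in `]0%R, +oo[) (s%:E * (pw w s)%:E) < +oo.
Proof.
have mk : measurable_fun setT (EFin \o pw w : measurableTypeR R -> \bar R).
  by apply/measurable_EFinP; exact: measurable_pw.
have k0 s : 0 <= (EFin \o pw w) s by rewrite lee_fin pw_ge0.
have := integral_dA_radial mk k0 => /= E.
set I := (X in X < _) in E *.
suff : 2%:E * I < +oo.
  have [//|] := ltP I +oo; rewrite leye_eq => /eqP ->; rewrite gt0_muley//.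
rewrite -E; case: ww => -[w0 /integrableP[_ iw]] rw _.
apply: le_lt_trans iw; rewrite [leRHS]integral_mkcond.
apply: ge0_le_integral_nonmeasurable => z _; first by rewrite lee_fin pw_ge0.
rewrite patchE; case: ifPn => [|zD].
  rewrite inE => Dz; rewrite /= lee_fin /pw; case: ifPn => _; last exact: normr_ge0.
  by rewrite (rw _ Dz) ler_norm.
rewrite lee_fin /pw; case: ifPn => // /andP[_ z1]; move: zD.
by rewrite notin_setE => /(_ z1).
Qed.

Lemma tailE (r : R) : (0 <= r)%R -> tail w r = tail_int (fun s => (pw w s)%:E) r.
Proof.
move=> r0; apply: eq_integral_unit => //.
  by apply/measurable_EFinP; exact: measurable_pw.
by move=> s s01; rewrite /pw s01.
Qed.

Lemma tail_gt0 (r : R) : (0 <= r < 1)%R -> 0 < tail w r.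
Proof.
move=> /andP[r0 r1]; case: ww => _ _ /(_ (r%:C)%C).
have -> : modc (r%:C)%C = r.
  by rewrite /modc/= expr0n/= addr0 sqrtr_sqr ger0_norm.
by apply; rewrite /disc/= /modc/= expr0n/= addr0 sqrtr_sqr ger0_norm.
Qed.

Lemma tail_lty (r : R) : (0 < r)%R -> tail w r < +oo.
Proof.
move=> r0; rewrite tailE ?ltW// /tail_int.
have m (D : set (measurableTypeR R)) : measurable_fun D (fun s : measurableTypeR R => (s%:E * (pw w s)%:E)).
  apply: emeasurable_funM; first by apply/measurable_EFinP; exact: measurable_id.
  by apply/measurable_EFinP; apply: measurable_funTS; exact: measurable_pw.
apply: (@le_lt_trans _ _ (r^-1%:E * \int[@leb R]_(s in `]0%R, +oo[) (s%:E * (pw w s)%:E))).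
  apply: (@le_trans _ _ (\int[@leb R]_(s in `[r, 1%R[) (r^-1%:E * (s%:E * (pw w s)%:E)))).
    apply: ge0_le_integral_nonmeasurable => s /=; rewrite in_itv/= => /andP[rs s1].
      by rewrite lee_fin pw_ge0.
    rewrite -!EFinM lee_fin mulrA ler_peMl ?pw_ge0//.
    by rewrite mulrC ler_pdivlMr// mul1r.
  rewrite ge0_integralZl//; last 2 first.
  - move=> s /=; rewrite in_itv/= => /andP[rs s1].
    by rewrite mule_ge0 ?lee_fin ?pw_ge0// ltW// (lt_le_trans r0).
  - by rewrite lee_fin invr_ge0 ltW.
  apply: lee_wpmul2l; first by rewrite lee_fin invr_ge0 ltW.
  apply: ge0_subset_integral => //.
  - by move=> s /=; rewrite in_itv/= andbT => s0; rewrite mule_ge0 ?lee_fin ?pw_ge0// ltW.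
  - by move=> s /=; rewrite !in_itv/= andbT => /andP[rs _]; rewrite (lt_le_trans r0).
apply: lte_mul_pinfty; rewrite ?lee_fin ?invr_ge0 ?(ltW r0)//.
exact: integral_pw_lty.
Qed.

Definition rtail (r : R) : R := fine (tail w r).

Lemma rtailE (r : R) : (0 < r)%R -> tail w r = (rtail r)%:E.
Proof.
move=> r0; have t0 : 0 <= tail w r.
  by rewrite (tailE (ltW r0)); apply: integral_ge0 => s _; rewrite lee_fin; exact: pw_ge0.
by rewrite /rtail fineK// (ge0_fin_numE t0) tail_lty.
Qed.

Lemma rtail_gt0 (r : R) : (0 < r < 1)%R -> (0 < rtail r)%R.
Proof.
by move=> /andP[r0 r1]; rewrite -lte_fin -rtailE// tail_gt0// ltW.
Qed.

Lemma tail_le (r r' : R) : (0 <= r)%R -> (r <= r')%R -> tail w r' <= tail w r.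
Proof.
move=> r0 rr'; rewrite !tailE ?(le_trans r0 rr')//; apply: tail_int_le => //.
  by apply/measurable_EFinP; exact: measurable_pw.
by move=> s; rewrite lee_fin pw_ge0.
Qed.

Lemma rtail_le (r r' : R) : (0 < r)%R -> (r <= r')%R -> (rtail r' <= rtail r)%R.
Proof.
move=> r0 rr'; rewrite -lee_fin -!rtailE//; last exact: lt_le_trans rr'.
by rewrite tail_le// ltW.
Qed.

End OneWeight.

Definition pdual (q : R) (w v : R[i] -> R) (s : R) : \bar R :=
  dual_value q (pw w s) (s * pw v s).

Lemma measurable_id_pw (v : R[i] -> R) : radial_weight v ->
  measurable_fun setT (fun s : measurableTypeR R => s * pw v s : measurableTypeR R)%R.
Proof. by move=> wv; apply: measurable_funM; [exact: measurable_id|exact: measurable_pw]. Qed.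

Lemma id_pw_ge0 (v : R[i] -> R) : radial_weight v -> forall s : R, (0 <= s * pw v s)%R.
Proof.
move=> wv s; have [s0|s0] := leP 0%R s; first by rewrite mulr_ge0// pw_ge0.
by rewrite /pw ltNge (ltW s0)/= mulr0.
Qed.

Lemma dual_intE (q : R) (w v : R[i] -> R) (r : R) : radial_weight w -> radial_weight v ->
  (0 <= r)%R -> dual_int q w v r = tail_int (pdual q w v) r.
Proof.
move=> ww wv r0; apply: eq_integral_unit => //.
  apply: measurable_dual_value; [exact: measurable_pw|exact: measurable_id_pw|exact: id_pw_ge0].
by move=> s s01; rewrite /dual_density /pdual /dual_value /pw s01.
Qed.

Lemma segment_intE (h : R[i] -> R) (t r : R) : radial_weight h -> (0 <= t)%R -> (r < 1)%R ->
  \int[@leb R]_(s in `[t, r]) (h s%:C%C * s)%:E =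
  \int[@leb R]_(s in `[t, r]) (s * pw h s)%:E.
Proof.
move=> wh t0 r1; apply: eq_integral_unit => //; last 2 first.
- exact: ltW.
- by move=> s s01; rewrite /pw s01 mulrC.
by apply/measurable_EFinP; exact: measurable_id_pw.
Qed.

End RadialParts.

(** * Sufficiency of the condition *)

Section Modulus.
Variable R : realType.
Implicit Types z : R[i].

Lemma modc_ge_Re z : `|complex.Re z| <= modc z.
Proof.
by case: z => a b; rewrite /modc/= -sqrtr_sqr ler_wsqrtr// lerDl sqr_ge0.
Qed.

Lemma modc_ge_Im z : `|complex.Im z| <= modc z.
Proof.
by case: z => a b; rewrite /modc/= -sqrtr_sqr ler_wsqrtr// lerDr sqr_ge0.
Qed.

Lemma modc_le_components z : modc z <= `|complex.Re z| + `|complex.Im z|.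
Proof.
case: z => a b; rewrite /modc/= -[leRHS]ger0_norm ?addr_ge0// -sqrtr_sqr ler_wsqrtr//.
rewrite sqrrD !real_normK ?num_real//.
have : 0 <= `|a| * `|b| by rewrite mulr_ge0.
by rewrite -mulr_natr; lra.
Qed.

Lemma modc_ge0 z : 0 <= modc z.
Proof. exact: le_trans (normr_ge0 _) (modc_ge_Re z). Qed.

Lemma modc_scale (c : R) z : 0 <= c -> modc (c%:C%C * z) = c * modc z.
Proof.
move=> c0; rewrite /modc Normc.normcM; congr (_ * _).
by rewrite /= expr0n/= addr0 sqrtr_sqr ger0_norm.
Qed.

Lemma measurable_modc (f : R[i] -> R[i]) : cmeasurable f ->
  measurable_fun (@cpt R @^-1` @disc R)
    (fun z : plane R => modc (f (cpt z)) : measurableTypeR R).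
Proof.
move=> [mRe mIm].
have m := measurable_funD (measurable_funX 2 mRe) (measurable_funX 2 mIm).
have := measurableT_comp (@measurable_powR R 2^-1) m.
apply: eq_measurable_fun => z _ /=; rewrite powR12_sqrt ?addr_ge0 ?sqr_ge0//.
by rewrite /modc; case: (f (cpt z)).
Qed.

End Modulus.

Section Sufficiency.
Local Open Scope ereal_scope.
Variables (R : realType) (p q N : R) (w v h : R[i] -> R).
Hypotheses (p1 : (1 < p)%R) (hpq : (p^-1 + q^-1 = 1)%R) (N0 : (0 < N)%R).
Hypotheses (ww : radial_weight w) (wv : radial_weight v) (wh : radial_weight h).
Hypothesis cond : forall t r : R, (0 < t)%R -> (t < r)%R -> (r < 1)%R ->
  \int[@leb R]_(s in `[t, r]) (s * pw h s)%:E * tail_int (pdual q w v) r `^ (p - 1) <=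
  ((N * rtail w t) `^ p)%:E.

Section OneFunction.
Variable f : R[i] -> R[i].
Hypothesis mf : cmeasurable f.

Let Dd : set (plane R) := @cpt R @^-1` @disc R.

Definition ray_modc (u : R * R) (s : R) : R :=
  if (0 < s < 1)%R then modc (f (cpt (s * u.1, s * u.2)%R)) else 0%R.

Let G u := tail_int (fun s => (ray_modc u s * pw w s)%:E).

Let ray_modc_ge0 u s : (0 <= ray_modc u s)%R.
Proof. by rewrite /ray_modc; case: ifPn => // _; exact: modc_ge0. Qed.

Let measurable_ray_modc u : (u.1 ^+ 2 + u.2 ^+ 2 = 1)%R ->
  measurable_fun setT (ray_modc u : measurableTypeR R -> measurableTypeR R).
Proof.
move=> u1; have := @measurable_ray _ _ _ _ u (0%R : measurableTypeR R) u1 (measurable_modc mf).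
exact.
Qed.

Let component_bound (c : R[i] -> R) (u : R * R) (s : R) :
  (forall z, `|c z| <= modc z)%R ->
  measurable_fun Dd (fun z => c (f (cpt z)) : measurableTypeR R) ->
  (u.1 ^+ 2 + u.2 ^+ 2 = 1)%R -> (0 < s < 1)%R -> G u s < +oo ->
  let z := cpt (s * u.1, s * u.2)%R in
  (@leb R).-integrable `[s, 1%R[ (fun s' => (c (f (ray z s')) * w s'%:C%C)%:E) /\
  (`|\int[@leb R]_(s' in `[s, 1%R[) (c (f (ray z s')) * w s'%:C%C)|%R)%:E <= G u s.
Proof.
move=> cm mc u1 /andP[s0 s1] Gs z.
have mS : measurable (`[s, 1%R[%classic : set (measurableTypeR R)) by exact: measurable_itv.
pose k (s' : R) : R := (if 0 < s' < 1 then c (f (cpt (s' * u.1, s' * u.2)) ) else 0)%R.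
have mk : measurable_fun setT (k : measurableTypeR R -> measurableTypeR R).
  have := @measurable_ray _ _ _ _ u (0%R : measurableTypeR R) u1 mc; exact.
have E s' : s' \in `[s, 1%R[%classic ->
    (c (f (ray z s')) * w s'%:C%C = k s' * pw w s')%R.
  rewrite inE/= in_itv/= => /andP[ss' s'1]; rewrite /z ray_cpt//.
  by rewrite /k /pw (lt_le_trans s0 ss') s'1.
have mkw : measurable_fun setT (fun s' : measurableTypeR R => k s' * pw w s' : measurableTypeR R)%R.
  by apply: measurable_funM => //; exact: measurable_pw.
have m : measurable_fun (`[s, 1%R[%classic : set (measurableTypeR R))
    (fun s' : measurableTypeR R => (c (f (ray z s')) * w s'%:C%C)%:E).
  apply/measurable_EFinP.
  apply: (eq_measurable_fun (fun s' : measurableTypeR R => k s' * pw w s' : measurableTypeR R)%R).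
    by move=> s' /E ->.
  exact: measurable_funTS.
have le : \int[@leb R]_(s' in `[s, 1%R[) `|(c (f (ray z s')) * w s'%:C%C)%:E| <= G u s.
  apply: ge0_le_integral_nonmeasurable => s' ss'; first exact: abse_ge0.
  rewrite E ?inE// lee_fin normrM (ger0_norm (pw_ge0 ww s')).
  apply: ler_wpM2r; first exact: pw_ge0.
  rewrite /k /ray_modc; case: ifPn => _; first exact: cm.
  by rewrite normr0.
have int : (@leb R).-integrable `[s, 1%R[ (fun s' => (c (f (ray z s')) * w s'%:C%C)%:E).
  by apply/integrableP; split => //; exact: le_lt_trans Gs.
split => //; rewrite EFin_normr_Rintegral//; apply: le_trans le.
exact: le_abse_integral.
Qed.

Let bad_point (u : R * R) (s lam : R) : (u.1 ^+ 2 + u.2 ^+ 2 = 1)%R -> (0 < s < 1)%R ->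
  (0 < lam)%R ->
  let z := cpt (s * u.1, s * u.2)%R in
  ~ Tavg_defined w f z \/ (lam < modc (Tavg w f z))%R ->
  (lam / 2 * rtail w s)%:E < G u s.
Proof.
move=> u1 s01 lam0 z; have /andP[s0 s1] := s01; apply: contraPP => /negP.
rewrite -leNgt => GL.
have Gs : G u s < +oo by rewrite (le_lt_trans GL) ?ltry.
have zs : modc z = s by rewrite modc_cpt pnorm_ray// ltW.
have [iR bR] := component_bound (@modc_ge_Re R) mf.1 u1 s01 Gs.
have [iI bI] := component_bound (@modc_ge_Im R) mf.2 u1 s01 Gs.
have def : Tavg_defined w f z by rewrite /Tavg_defined zs; split.
apply/not_orP; split; first by move=> /(_ def).
apply/negP; rewrite -leNgt /Tavg zs.
have O0 := rtail_gt0 ww s01.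
rewrite modc_scale; last by rewrite invr_ge0; exact: ltW.
rewrite ler_pdivrMl//; apply: le_trans (modc_le_components _) _ => /=.
have bR' := le_trans bR GL; have bI' := le_trans bI GL.
rewrite !lee_fin in bR' bI'; rewrite -/(rtail w s).
have := lerD bR' bI'; rewrite -/z; move/le_trans; apply.
by rewrite -mulrDl -splitr mulrC.
Qed.

Let c (lam : R) : R := (2 * (4 * N) `^ p / (lam / 2) `^ p)%R.

Lemma wmeas_bad_le (lam : R) (E : set R[i]) : (0 < lam)%R ->
  (forall z, E z -> [/\ @disc R z, z != 0%R &
     ~ Tavg_defined w f z \/ (lam < modc (Tavg w f z))%R]) ->
  wmeas h E <= (c lam)%:E * Lpnorm_pow p v f.
Proof.
move=> lam0 HE; have [p0 q0 q1 pq] := conj_exponent p1 hpq.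
have l20 : (0 < lam / 2)%R by rewrite divr_gt0.
have c0 : (0 <= c lam)%R by rewrite /c divr_ge0 ?mulr_ge0 ?powR_ge0.
pose F0 : plane R -> \bar R := (fun z : plane R => (modc (f (cpt z)) `^ p * v (cpt z))%:E) \_ Dd.
pose F1 : plane R -> \bar R := (fun z : plane R => (h (cpt z))%:E) \_ (@cpt R @^-1` E).
have mD : measurable Dd by exact: measurable_disc.
have mF : measurable_fun Dd (fun z : plane R => (modc (f (cpt z)) `^ p * v (cpt z))%:E).
  apply/measurable_EFinP; apply: measurable_funM; last exact: measurable_weight.
  exact: (measurableT_comp (@measurable_powR R p) (measurable_modc mf)).
have v0 z : Dd z -> (0 <= v (cpt z))%R by case: wv => -[+ _] _ _; apply.
have F00 z : 0 <= F0 z.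
  apply: erestrict_ge0 => {}z Dz; rewrite lee_fin mulr_ge0 ?powR_ge0//; exact: v0.
have mF0 : measurable_fun setT F0 by apply/(measurable_restrictT _ mD).
have F10 z : 0 <= F1 z.
  apply: erestrict_ge0 => {}z /HE[Dz _ _]; rewrite lee_fin.
  by case: wh => -[+ _] _ _; apply.
rewrite /wmeas /int_dA [leLHS]integral_mkcond -/F1.
have -> : (c lam)%:E * Lpnorm_pow p v f = \int[@dA R]_z ((c lam)%:E * F0 z).
  rewrite ge0_integralZl//; congr (_ * _).
  by rewrite /Lpnorm_pow /int_dA [LHS]integral_mkcond.
apply: le_integral_dA => //.
- by apply: emeasurable_funM => //; exact: measurable_cst.
- by move=> z; apply: mule_ge0; [rewrite lee_fin; exact: c0|exact: F00].
move=> u u1.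
pose b (s : measurableTypeR R) : measurableTypeR R := (s * pw v s)%R.
pose k (s : measurableTypeR R) : \bar R := (ray_modc u s `^ p * b s)%:E.
have b0 s : (0 <= b s)%R by exact: id_pw_ge0.
have mb : measurable_fun setT b by exact: measurable_id_pw.
have mk : measurable_fun setT k.
  apply/measurable_EFinP; apply: measurable_funM => //.
  exact: (measurableT_comp (@measurable_powR R p) (measurable_ray_modc u1)).
have k0 s : 0 <= k s by rewrite lee_fin mulr_ge0 ?powR_ge0.
pose bad := `]0%R, 1%R[%classic `&` [set s | (lam / 2 * rtail w s)%:E < G u s].
have W : ((lam / 2) `^ p)%:E * \int[@leb R]_(s in bad) (s * pw h s)%:E <=
    (2 * (4 * N) `^ p)%:E * \int[@leb R]_(s in `]0%R, 1%R[) k s.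
  apply: (@weak_type_weights R p q N (lam / 2)%R p1 hpq N0 l20
    (fun s => s * pw h s)%R (ray_modc u) (pw w) b (rtail w)) => //.
  - exact: measurable_id_pw.
  - exact: measurable_ray_modc.
  - exact: measurable_pw.
  - exact: id_pw_ge0.
  - exact: pw_ge0.
  - by move=> s; exact: rtail_gt0.
  - by move=> s s' s0 ss' _; exact: rtail_le.
have {}W : \int[@leb R]_(s in bad) (s * pw h s)%:E <= (c lam)%:E * \int[@leb R]_(s in `]0%R, 1%R[) k s.
  have lp : (0 < (lam / 2) `^ p)%R by rewrite powR_gt0.
  rewrite -(@lee_pmul2l _ ((lam / 2) `^ p)%:E)// ?lte_fin//.
  apply: le_trans W _; rewrite muleA -EFinM /c.
  rewrite [((lam / 2) `^ p * _)%R]mulrC divfK//; exact: lt0r_neq0.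
apply: (@le_trans _ _ (\int[@leb R]_(s in bad) (s * pw h s)%:E)).
  rewrite /ray_int [leLHS]integral_mkcond [leRHS]integral_mkcond.
  apply: ge0_le_integral_nonmeasurable => s _.
    apply: erestrict_ge0 => {}s; rewrite /= in_itv/= andbT => s0.
    by apply: mule_ge0; [rewrite lee_fin ltW|exact: F10].
  have R0 : 0 <= ((fun s : R => (s * pw h s)%:E) \_ bad) s.
    by apply: erestrict_ge0 => {}s _; rewrite lee_fin; exact: id_pw_ge0.
  rewrite patchE; case: ifPn => //; rewrite inE/= in_itv/= andbT => s0.
  rewrite /F1 patchE; case: ifPn => [|_]; last by rewrite mule0.
  rewrite inE => /= Es; have [Ds _ Hs] := HE _ Es.
  have s1 : (s < 1)%R.
    by have : (pnorm (s * u.1, s * u.2) < 1)%R := Ds; rewrite pnorm_ray// ltW.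
  have s01 : (0 < s < 1)%R by rewrite s0.
  rewrite patchE mem_set; last by split; [rewrite /= in_itv|exact: bad_point].
  by rewrite (pw_cpt wh u1 s01) -EFinM.
apply: le_trans W _; rewrite -ge0_integralZl//; last exact: measurable_funTS.
rewrite /ray_int [leLHS]integral_mkcond [leRHS]integral_mkcond.
apply: ge0_le_integral_nonmeasurable => s _.
  by apply: erestrict_ge0 => {}s _; apply: mule_ge0; [rewrite lee_fin; exact: c0|exact: k0].
have R0 : 0 <= ((fun s : R => s%:E * ((c lam)%:E * F0 (s * u.1, s * u.2)%R)) \_ `]0%R, +oo[) s.
  apply: erestrict_ge0 => {}s /=; rewrite in_itv/= andbT => s0.
  apply: mule_ge0; first by rewrite lee_fin ltW.
  by apply: mule_ge0; [rewrite lee_fin; exact: c0|exact: F00].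
rewrite patchE; case: ifPn => //; rewrite inE/= in_itv/= => s01.
have /andP[s0 s1] := s01.
rewrite patchE mem_set; last by rewrite /= in_itv/= s0.
rewrite /F0 patchE mem_set; last exact: disc_ray.
rewrite /k /b /ray_modc s01 (pw_cpt wv u1 s01) -!EFinM lee_fin.
by rewrite le_eqVlt; apply/orP; left; apply/eqP; ring.
Qed.

End OneFunction.

Let constant_le (lam : R) : (0 < lam)%R ->
  (lam `^ p * (2 * (4 * N) `^ p / (lam / 2) `^ p) <= (16 * N) `^ p)%R.
Proof.
move=> lam0; have [p0 q0 _ _] := conj_exponent p1 hpq.
have l2 : (0 < lam / 2)%R by rewrite divr_gt0.
have N4 : (0 <= 4 * N)%R by rewrite mulr_ge0 ?(ltW N0).
have E1 : (lam `^ p = (lam / 2) `^ p * 2 `^ p)%R by rewrite -powRM ?(ltW l2)// divfK.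
have E2 : ((16 * N) `^ p = 2 `^ p * (2 `^ p * (4 * N) `^ p))%R.
  have -> : (16 * N = 2 * (2 * (4 * N)))%R by ring.
  have N8 : (0 <= 2 * (4 * N))%R by rewrite mulr_ge0.
  by rewrite (@powRM _ 2 (2 * (4 * N)))%R// (@powRM _ 2 (4 * N))%R.
rewrite E1 E2.
have lp : ((lam / 2) `^ p != 0)%R by rewrite gt_eqF// powR_gt0.
have -> : ((lam / 2) `^ p * 2 `^ p * (2 * (4 * N) `^ p / (lam / 2) `^ p) =
  2 * (2 `^ p * (4 * N) `^ p))%R.
  by field.
by rewrite ler_wpM2r ?mulr_ge0 ?powR_ge0// le1r_powR// ?ler1n// ltW.
Qed.

Lemma weak_bound_of_cond : weak_bound p w v h (16 * N).
Proof.
have [p0 q0 q1 pq] := conj_exponent p1 hpq.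
move=> f [mf Lf].
have L0 : 0 <= Lpnorm_pow p v f.
  apply: integral_ge0 => z Dz; rewrite lee_fin mulr_ge0 ?powR_ge0//.
  by case: wv => -[+ _] _ _; apply.
have bound lam (E : set R[i]) : (0 < lam)%R ->
  (forall z, E z -> [/\ @disc R z, z != 0%R &
     ~ Tavg_defined w f z \/ (lam < modc (Tavg w f z))%R]) ->
  (lam `^ p)%:E * wmeas h E <= ((16 * N) `^ p)%:E * Lpnorm_pow p v f.
  move=> lam0 HE.
  apply: le_trans (lee_wpmul2l _ (wmeas_bad_le mf lam0 HE)) _.
    by rewrite lee_fin powR_ge0.
  by rewrite muleA -EFinM; apply: lee_wpmul2r => //; rewrite lee_fin constant_le.
split; last by move=> lam lam0; apply: bound => // z [Dz zn0 ?]; split => //; right.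
have X0 : 0 <= wmeas h (divergence_set w f).
  apply: integral_ge0 => z [Dz _ _]; rewrite lee_fin.
  by case: wh => -[+ _] _ _; apply.
have div lam : (0 < lam)%R -> (lam `^ p)%:E * wmeas h (divergence_set w f) <=
    ((16 * N) `^ p)%:E * Lpnorm_pow p v f.
  by move=> lam0; apply: bound => // z [Dz zn0 ?]; split => //; left.
have Kfin : ((16 * N) `^ p)%:E * Lpnorm_pow p v f \is a fin_num.
  by rewrite fin_numM// ge0_fin_numE.
move: div X0; rewrite -(fineK Kfin); set K := fine _.
have K0 : (0 <= K)%R by rewrite fine_ge0// mule_ge0// lee_fin powR_ge0.
case: (wmeas _ _) => [x| |] div X0 //; last first.
  by have := div 1%R ltr01; rewrite gt0_muley ?lte_fin ?powR_gt0.
rewrite lee_fin in X0; congr EFin; apply/eqP; rewrite eq_le X0 andbT leNgt.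
apply/negP => x0.
have Kx : (0 < (K + 1) / x)%R by rewrite divr_gt0// ltr_wpDl.
have := div (((K + 1) / x) `^ p^-1)%R; rewrite powR_gt0// => /(_ isT).
rewrite -powRrM mulVf ?gt_eqF// powRr1 ?(ltW Kx)// -EFinM lee_fin divfK ?gt_eqF//.
by rewrite gerDl ler10.
Qed.

End Sufficiency.

(** * Necessity of the condition *)

Section Truncation.
Variables (R : realType) (q : R).
Hypothesis q1 : 1 < q.

(* The extremal function of Hoelder's inequality, with numerator and denominator
   truncated so that it is bounded. *)
Definition trunc_test (n : nat) (a b : R) : R :=
  (Num.min a n.+1%:R / Num.max b n.+1%:R^-1) `^ (q - 1).

Definition trunc_dual (n : nat) (a b : R) : R := trunc_test n a b * Num.min a n.+1%:R.

Let min_ge0 n (a : R) : 0 <= a -> 0 <= Num.min a n.+1%:R.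
Proof. by move=> a0; rewrite le_min a0/=. Qed.

Let max_gt0 n (b : R) : 0 < Num.max b n.+1%:R^-1.
Proof. by rewrite lt_max invr_gt0 ltr0Sn orbT. Qed.

Lemma trunc_test_ge0 n a b : 0 <= trunc_test n a b.
Proof. exact: powR_ge0. Qed.

Lemma trunc_dual_ge0 n a b : 0 <= a -> 0 <= trunc_dual n a b.
Proof. by move=> a0; rewrite mulr_ge0 ?trunc_test_ge0// min_ge0. Qed.

Lemma trunc_test_le n a b : 0 <= a -> trunc_test n a b <= (n.+1%:R ^+ 2) `^ (q - 1).
Proof.
move=> a0; apply: ge0_ler_powR; rewrite ?nnegrE ?subr_ge0 ?(ltW q1) ?exprn_ge0//.
  by rewrite divr_ge0 ?min_ge0// ltW.
rewrite ler_pdivrMr// expr2 -mulrA.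
apply: (@le_trans _ _ n.+1%:R); first by rewrite ge_min lexx orbT.
rewrite ler_peMr// -[leLHS](@mulfV _ n.+1%:R) ?pnatr_eq0// ler_wpM2l//.
by rewrite le_max lexx orbT.
Qed.

Lemma trunc_dual_nd n m a b : 0 <= a -> (n <= m)%N -> trunc_dual n a b <= trunc_dual m a b.
Proof.
move=> a0 nm; have nm' : n.+1%:R <= m.+1%:R :> R by rewrite ler_nat.
have h1 : Num.min a n.+1%:R <= Num.min a m.+1%:R.
  by rewrite le_min !ge_min lexx/= nm' orbT.
apply: ler_pM; rewrite ?powR_ge0 ?min_ge0//.
apply: ge0_ler_powR; rewrite ?nnegrE ?subr_ge0 ?(ltW q1)//.
- by rewrite divr_ge0 ?min_ge0// ltW.
- by rewrite divr_ge0 ?min_ge0// ltW.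
apply: ler_pM; rewrite ?min_ge0 ?invr_ge0 ?(ltW (max_gt0 _ _))//.
rewrite lef_pV2 ?posrE ?max_gt0// ge_max !le_max lexx/=.
by rewrite lef_pV2 ?posrE ?ltr0Sn// nm' orbT.
Qed.

Lemma trunc_dual_cvg a b : 0 <= a -> 0 <= b ->
  (trunc_dual n a b)%:E @[n --> \oo] --> dual_value q a b.
Proof.
move=> a0 b0; have q0 : 0 < q - 1 by rewrite subr_gt0.
have near_a : \forall n \near \oo, a <= n.+1%:R.
  near=> n; apply: (@le_trans _ _ n%:R); last by rewrite ler_nat.
  by near: n; exact: nbhs_infty_ger.
rewrite /dual_value; have [bE|bn0] := eqVneq b 0.
  have [aE|an0] := eqVneq a 0.
    rewrite aE mul0e; apply: cvg_near_cst; apply: nearW => n.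
    by rewrite /trunc_dual min_l// mulr0.
  have a_gt0 : 0 < a by rewrite lt_neqAle eq_sym an0.
  rewrite gt0_muley ?lte_fin//; apply/cvgeyPge => A.
  have [A0|A0] := leP A 0.
    by apply: nearW => n; rewrite lee_fin (le_trans A0)// trunc_dual_ge0.
  near=> n; have an : a <= n.+1%:R by near: n.
  rewrite lee_fin /trunc_dual /trunc_test (min_l an) bE (max_r _) ?invr_ge0//.
  rewrite invrK -ler_pdivrMr//.
  have -> : A / a = ((A / a) `^ (q - 1)^-1) `^ (q - 1).
    by rewrite -powRrM mulVf ?gt_eqF// powRr1// divr_ge0// ltW.
  apply: ge0_ler_powR; rewrite ?nnegrE ?powR_ge0 ?(ltW q0) ?mulr_ge0//.
  rewrite [leRHS]mulrC -ler_pdivrMr//; apply: (@le_trans _ _ n%:R); last by rewrite ler_nat.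
  by near: n; exact: nbhs_infty_ger.
have b_gt0 : 0 < b by rewrite lt_neqAle eq_sym bn0.
apply: cvg_near_cst; near=> n; have an : a <= n.+1%:R by near: n.
have bn : b^-1 <= n.+1%:R.
  apply: (@le_trans _ _ n%:R); last by rewrite ler_nat.
  by near: n; exact: nbhs_infty_ger.
have bn' : n.+1%:R^-1 <= b.
  by rewrite -[leRHS]invrK lef_pV2 ?posrE ?ltr0Sn// invr_gt0.
congr EFin; rewrite /trunc_dual /trunc_test (min_l an) (max_l bn').
have ab0 : 0 <= a / b by rewrite divr_ge0.
have q00 : 0 < q by exact: lt_trans q1.
by rewrite -(mulr_powRB1 ab0 q00); field.
Unshelve. all: by end_near. Qed.

Lemma measurable_trunc_test n (a b : measurableTypeR R -> measurableTypeR R) :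
  measurable_fun setT a -> measurable_fun setT b -> (forall s, 0 <= a s) ->
  measurable_fun setT (fun s => trunc_test n (a s) (b s) : measurableTypeR R).
Proof.
move=> ma mb a0.
have m1 : measurable_fun setT (fun s => Num.min (a s) n.+1%:R : measurableTypeR R).
  by apply: measurable_minr => //; exact: measurable_cst.
have m2 : measurable_fun setT (fun s => Num.max (b s) n.+1%:R^-1 : measurableTypeR R).
  by apply: measurable_maxr => //; exact: measurable_cst.
have m3 : measurable_fun setT (fun s => (Num.max (b s) n.+1%:R^-1)^-1 : measurableTypeR R).
  have := measurableT_comp (@measurable_powR R (-1)) m2.
  by apply: eq_measurable_fun => s _ /=; rewrite powR_inv1// ltW.
exact: (measurableT_comp (@measurable_powR R (q - 1)) (measurable_funM m1 m3)).
Qed.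

Lemma trunc_test_powR (p : R) n a b : 1 < p -> p^-1 + q^-1 = 1 -> 0 <= a -> 0 <= b ->
  trunc_test n a b `^ p * b <= trunc_dual n a b.
Proof.
move=> p1 hpq a0 b0; have [p0 q0 _ pq] := conj_exponent p1 hpq.
have x0 : 0 <= Num.min a n.+1%:R / Num.max b n.+1%:R^-1 by rewrite divr_ge0 ?min_ge0// ltW.
rewrite -(mulr_powRB1 (trunc_test_ge0 n a b) p0) -mulrA ler_wpM2l ?trunc_test_ge0//.
rewrite /trunc_test -powRrM.
have -> : (q - 1) * (p - 1) = 1.
  have pE : p - 1 = p / q by [].
  have pqs : p + q = p * q.
    have := hpq; have pn := lt0r_neq0 p0; have qn := lt0r_neq0 q0.
    move=> /(congr1 (fun x => x * (p * q))).
    rewrite mul1r => <-; by field; rewrite pn qn.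
  by rewrite mulrBl !mulrBr; lra.
rewrite powRr1// -mulrA ler_piMr ?min_ge0//.
by rewrite mulrC ler_pdivrMr// mul1r le_max lexx.
Qed.

End Truncation.

Section Necessity.
Local Open Scope ereal_scope.
Variables (R : realType) (p q C : R) (w v h : R[i] -> R).
Hypotheses (p1 : (1 < p)%R) (hpq : (p^-1 + q^-1 = 1)%R) (C0 : (0 <= C)%R).
Hypotheses (ww : radial_weight w) (wv : radial_weight v) (wh : radial_weight h).
Hypothesis wb : weak_bound p w v h C.
Variables (t r : R).
Hypotheses (t0 : (0 <= t)%R) (tr : (t < r)%R) (r1 : (r < 1)%R).
Hypothesis tfin : tail w t < +oo.

Let r0 : (0 < r)%R. Proof. exact: le_lt_trans tr. Qed.
Let q1 : (1 < q)%R. Proof. by have [] := conj_exponent p1 hpq. Qed.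
Let p0 : (0 < p)%R. Proof. exact: lt_trans p1. Qed.

Let b (s : R) : R := (s * pw v s)%R.
Let Ir : set (measurableTypeR R) := `[r, 1%R[%classic.
Let mIr : measurable Ir. Proof. exact: measurable_itv. Qed.
Let O := rtail w t.
Let Ot : tail w t = O%:E.
Proof.
rewrite /O /rtail fineK// ge0_fin_numE//; rewrite tailE//.
by apply: integral_ge0 => s _; rewrite lee_fin; exact: pw_ge0.
Qed.
Let O0 : (0 < O)%R.
Proof. by rewrite -lte_fin -Ot tail_gt0// t0 (lt_trans tr). Qed.

Let H := \int[@leb R]_(s in `[t, r]) (s * pw h s)%:E.

Let Hfin : H < +oo.
Proof.
apply: le_lt_trans (integral_pw_lty wh).
rewrite [leLHS]integral_mkcond [leRHS]integral_mkcond.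
apply: ge0_le_integral_nonmeasurable => s _.
  by apply: erestrict_ge0 => {}s _; rewrite lee_fin id_pw_ge0.
rewrite !patchE; case: ifPn => [_|_].
  case: ifPn => [_|]; first by rewrite EFinM.
  rewrite notin_setE/= in_itv/= andbT => /negP; rewrite -leNgt => s0.
  by rewrite /pw ltNge s0/= mulr0.
by case: ifPn => //; rewrite inE/= in_itv/= andbT => s0; rewrite mule_ge0 ?lee_fin ?pw_ge0// ltW.
Qed.

Let H0 : 0 <= H.
Proof. by apply: integral_ge0 => s _; rewrite lee_fin id_pw_ge0. Qed.

Section Level.
Variable n : nat.

Let g (s : R) : R := if (r <= s < 1)%R then trunc_test q n (pw w s) (b s) else 0%R.

Let f (z : R[i]) : R[i] := (g (modc z))%:C%C.

Let g0 s : (0 <= g s)%R.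
Proof. by rewrite /g; case: ifPn => // _; exact: trunc_test_ge0. Qed.

Let mg : measurable_fun setT (g : measurableTypeR R -> measurableTypeR R).
Proof.
have mt : measurable_fun setT (fun s => trunc_test q n (pw w s) (b s) : measurableTypeR R).
  by apply: measurable_trunc_test; [exact: measurable_pw|exact: measurable_id_pw|exact: pw_ge0].
have := iffLR (measurable_restrictT _ mIr) (measurable_funTS mt).
apply: eq_measurable_fun => s _; rewrite /g patchE /Ir.
case: ifPn; first by rewrite inE/= in_itv/= => ->.
by rewrite notin_setE/= in_itv/= => /negP/negbTE ->.
Qed.

Let modcf z : modc (f z) = g (modc z).
Proof. by rewrite /f /modc/= expr0n/= addr0 sqrtr_sqr ger0_norm. Qed.

Let cmf : cmeasurable f.
Proof.
split; last by apply: measurable_funTS; exact: measurable_cst.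
by apply: measurable_funTS; exact: (measurableT_comp mg (@measurable_pnorm R)).
Qed.

Definition trunc_int : \bar R := \int[@leb R]_(s in Ir) (trunc_dual q n (pw w s) (b s))%:E.

Let D0 : 0 <= trunc_int.
Proof. by apply: integral_ge0 => s _; rewrite lee_fin trunc_dual_ge0// pw_ge0. Qed.

Let mgw : measurable_fun setT (fun s : measurableTypeR R => g s * pw w s : measurableTypeR R)%R.
Proof. by apply: measurable_funM => //; exact: measurable_pw. Qed.

Let I := \int[@leb R]_(s in Ir) (g s * pw w s)%:E.

Let gwE (s : R) : (t <= s <= r)%R -> \int[@leb R]_(s' in `[s, 1%R[) (g s' * pw w s')%:E = I.
Proof.
move=> /andP[ts sr]; rewrite /I [LHS]integral_mkcond [RHS]integral_mkcond.
apply: eq_integral => x _; rewrite !patchE /Ir.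
case: ifPn => [|].
  rewrite inE/= in_itv/= => /andP[sx x1]; case: ifPn => //.
  rewrite notin_setE/= in_itv/= x1 andbT => /negP/negbTE rx.
  by rewrite /g rx mul0r.
rewrite notin_setE/= in_itv/= => nx; rewrite ifF//.
apply/negbTE; rewrite notin_setE/= in_itv/= => /andP[rx x1].
have : (s <= x < 1)%R by rewrite x1 (le_trans sr).
exact: nx.
Qed.

Let Ifin : I < +oo.
Proof.
have M0 : (0 <= (n.+1%:R ^+ 2) `^ (q - 1) :> R)%R by exact: powR_ge0.
apply: (@le_lt_trans _ _ (((n.+1%:R ^+ 2) `^ (q - 1))%:E * tail w r)).
  rewrite (tailE ww (ltW r0)) /tail_int -ge0_integralZl//; last 2 first.
  - by apply/measurable_EFinP; apply: measurable_funTS; exact: measurable_pw.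
  - by move=> s _; rewrite lee_fin pw_ge0.
  apply: ge0_le_integral_nonmeasurable => s _; first by rewrite lee_fin mulr_ge0// pw_ge0.
  rewrite -EFinM lee_fin ler_wpM2r ?pw_ge0// /g; case: ifPn => // _.
  by apply: trunc_test_le => //; exact: pw_ge0.
by apply: lte_mul_pinfty => //; exact: tail_lty.
Qed.

Let DI : trunc_int <= I.
Proof.
apply: ge0_le_integral_nonmeasurable => s; first by rewrite lee_fin trunc_dual_ge0// pw_ge0.
rewrite /Ir/= in_itv/= => rs1; rewrite lee_fin /g rs1 /trunc_dual.
by rewrite ler_wpM2l ?trunc_test_ge0// ge_min lexx.
Qed.

Let Dfin : trunc_int < +oo. Proof. exact: le_lt_trans DI Ifin. Qed.

Let norm_le : Lpnorm_pow p v f <= 2%:E * trunc_int.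
Proof.
pose k (s : measurableTypeR R) : \bar R := (g s `^ p * pw v s)%:E.
have mk : measurable_fun setT k.
  apply/measurable_EFinP; apply: measurable_funM; last exact: measurable_pw.
  exact: (measurableT_comp (@measurable_powR R p) mg).
have k0 s : 0 <= k s by rewrite lee_fin mulr_ge0 ?powR_ge0 ?pw_ge0.
have := integral_dA_radial mk k0; set J := (X in _ = _ * X) => E.
apply: (@le_trans _ _ (2%:E * J)); last first.
  apply: lee_wpmul2l; first by rewrite lee_fin.
  rewrite /J /trunc_int [leLHS]integral_mkcond [leRHS]integral_mkcond.
  apply: ge0_le_integral_nonmeasurable => s _.
    by apply: erestrict_ge0 => {}s /=; rewrite in_itv/= andbT => s0; rewrite mule_ge0// lee_fin ltW.
  rewrite !patchE; case: ifPn => [|_]; last first.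
    by case: ifPn => // _; rewrite lee_fin trunc_dual_ge0// pw_ge0.
  rewrite inE/= in_itv/= andbT => s0; rewrite /k /g; case: ifPn => [rs1|nrs].
    rewrite mem_set; last by rewrite /Ir/= in_itv.
    rewrite -EFinM lee_fin mulrCA.
    by apply: (trunc_test_powR _ p1 hpq) => //; [exact: pw_ge0|exact: id_pw_ge0].
  rewrite powR0 ?gt_eqF// mul0r mule0; case: ifPn => // _.
  by rewrite lee_fin trunc_dual_ge0// pw_ge0.
rewrite -E /Lpnorm_pow /int_dA [leLHS]integral_mkcond.
apply: ge0_le_integral_nonmeasurable => z _.
  apply: erestrict_ge0 => {}z Dz; rewrite lee_fin mulr_ge0 ?powR_ge0//.
  by case: wv => -[+ _] _ _; apply.
rewrite patchE; case: ifPn => // /set_mem Dz.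
rewrite modcf modc_cpt /k lee_fin; have [gz|gz] := eqVneq (g (pnorm z)) 0%R.
  by rewrite gz powR0 ?gt_eqF// !mul0r.
rewrite ler_wpM2l ?powR_ge0// (radial_cpt wv Dz) /pw.
suff -> : (0 < pnorm z < 1)%R by [].
move: gz; rewrite /g; case: ifPn; last by rewrite eqxx.
by move=> /andP[rz ->] _; rewrite (lt_le_trans r0).
Qed.

Let level_ge (lam : R) : (0 < lam)%R -> (lam * O)%:E < trunc_int ->
  2%:E * H <= wmeas h (level_set w f lam).
Proof.
move=> lam0 lO.
pose k (s : measurableTypeR R) : \bar R := (pw h s)%:E * (\1_(`[t, r]%classic) s)%:E.
have mk : measurable_fun setT k.
  apply: emeasurable_funM; apply/measurable_EFinP; first exact: measurable_pw.
  by apply: measurable_indic; exact: measurable_itv.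
have k0 s : 0 <= k s by rewrite mule_ge0 ?lee_fin ?pw_ge0.
have := integral_dA_radial mk k0; set J := (X in _ = _ * X) => E.
have HJ : H <= J.
  rewrite /H /J [leLHS]integral_mkcond [leRHS]integral_mkcond.
  apply: ge0_le_integral_nonmeasurable => s _.
    by apply: erestrict_ge0 => {}s _; rewrite lee_fin id_pw_ge0.
  rewrite !patchE; case: ifPn => [|_]; last first.
    case: ifPn => //; rewrite inE/= in_itv/= andbT => s0.
    by rewrite mule_ge0// lee_fin ltW.
  rewrite inE => ts; case: ifPn => [_|].
    by rewrite /k indicE mem_set// mule1 EFinM.
  rewrite notin_setE/= in_itv/= andbT => /negP; rewrite -leNgt => s0.
  by rewrite /pw ltNge s0/= mulr0.
apply: (@le_trans _ _ (2%:E * J)); first by apply: lee_wpmul2l; rewrite ?lee_fin.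
rewrite -E /wmeas /int_dA [leRHS]integral_mkcond.
apply: ge0_le_integral_nonmeasurable => z _ //.
have level0 : 0 <= ((fun z : plane R => (h (cpt z))%:E) \_ (@cpt R @^-1` level_set w f lam)) z.
  apply: erestrict_ge0 => {}z [Dz _ _]; rewrite lee_fin.
  by case: wh => -[+ _] _ _; apply.
rewrite /k; have [nz|] := boolP (pnorm z \in `[t, r]%classic); last first.
  by move=> nz; rewrite indicE (negbTE nz) mule0.
rewrite indicE nz mule1 /pw; case: ifPn => // /andP[z0 z1].
have Dz : @disc R (cpt z) by [].
rewrite -(radial_cpt wh Dz) patchE mem_set//=; split => //.
  apply/eqP => zE; move: z0; rewrite -modc_cpt zE /modc/= expr0n/= addr0 sqrtr0.
  by rewrite ltxx.
move: nz; rewrite inE/= in_itv/= => tzr.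
set s := pnorm z in z0 z1 tzr *.
have s01 : (0 < s < 1)%R by rewrite z0.
have sc0 : (s%:C)%C != 0%R :> R[i] by apply/eqP => -[/eqP]; rewrite gt_eqF.
have modc_ray (s' : R) : (0 <= s')%R -> modc (ray (cpt z) s') = s'.
  move=> s'0; rewrite /ray modc_scale// modc_cpt -/s mulrC.
  have -> : (cpt z / (s%:C)%C = (s^-1)%:C%C * cpt z)%R by rewrite mulrC -fmorphV.
  by rewrite modc_scale ?invr_ge0 ?(ltW z0)// modc_cpt -/s mulVf ?gt_eqF// mul1r.
have Ref (s' : R) : (0 <= s')%R -> complex.Re (f (ray (cpt z) s')) = g s'.
  by move=> s'0; rewrite -[in RHS](modc_ray _ s'0).
have IE : (\int[@leb R]_(s' in `[s, 1%R[) (complex.Re (f (ray (cpt z) s')) * w s'%:C%C))%R = fine I.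
  rewrite /Rintegral -(gwE tzr); congr fine; apply: eq_integral => s' ss.
  have /andP[ss' s'1] : (s <= s' < 1)%R by move: ss; rewrite inE/= in_itv.
  have s'0 := lt_le_trans z0 ss'.
  by rewrite Ref ?(ltW s'0)// /pw s'0 s'1.
have Os := rtail_gt0 ww s01.
change (lam < modc (Tavg w f (cpt z)))%R.
rewrite /Tavg (modc_cpt z) -/s modc_scale ?invr_ge0 ?(ltW Os)// -/(rtail w s).
apply: lt_le_trans (ler_wpM2l _ (modc_ge_Re _)); last by rewrite invr_ge0 ltW.
rewrite /= IE; apply: lt_le_trans (ler_wpM2l _ (ler_norm _)); last by rewrite invr_ge0 ltW.
rewrite ltr_pdivlMl// mulrC -lte_fin.
have I0 : 0 <= I by exact: le_trans D0 DI.
rewrite fineK ?ge0_fin_numE//; apply: lt_le_trans DI; apply: le_lt_trans lO.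
rewrite lee_fin ler_wpM2l ?(ltW lam0)// -lee_fin -Ot -rtailE// tail_le//.
by case/andP: tzr.
Qed.

Lemma trunc_int_bound : trunc_int `^ (p - 1) * H <= ((C * O) `^ p)%:E.
Proof.
have Lf : Lp p v f by split => //; apply: le_lt_trans norm_le _; rewrite lte_mul_pinfty.
have [_ wbf] := wb Lf.
have K lam : (0 < lam)%R -> (lam * O)%:E < trunc_int ->
    (lam `^ p)%:E * H <= (C `^ p)%:E * trunc_int.
  move=> lam0 lO; rewrite -(@lee_pmul2l _ 2%:E)//.
  rewrite muleCA [leRHS]muleCA.
  apply: (@le_trans _ _ ((C `^ p)%:E * Lpnorm_pow p v f)); last first.
    by apply: lee_wpmul2l norm_le; rewrite lee_fin powR_ge0.
  apply: le_trans (wbf lam lam0); apply: lee_wpmul2l; last exact: level_ge.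
  by rewrite lee_fin powR_ge0.
move: K D0 Dfin H0 Hfin; case: trunc_int => [d| |] // K d0 _; move: K; case: H => [x| |] // K x0 _.
rewrite poweR_EFin -EFinM lee_fin; rewrite !lee_fin in d0 x0.
have [dE|dn0] := eqVneq d 0%R.
  by rewrite dE powR0 ?mul0r ?powR_ge0// gt_eqF// subr_gt0.
have dgt0 : (0 < d)%R by rewrite lt_neqAle eq_sym dn0.
rewrite powRM ?(ltW O0)// -(ler_pM2l dgt0) mulrA mulr_powRB1//.
set a := (C `^ p * d)%R.
have -> : (d * (C `^ p * O `^ p) = O `^ p * a)%R by rewrite /a; ring.
have Op : (0 < O `^ p)%R by rewrite powR_gt0.
rewrite -ler_pdivrMl// mulrA.
have -> : ((O `^ p)^-1 * d `^ p = (d / O) `^ p)%R.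
  by rewrite powRM ?invr_ge0 ?(ltW O0)// mulrC -(powR_inv1 (ltW O0)) -powRrM mulN1r powRN.
rewrite leNgt; apply/negP => ax.
have a0 : (0 <= a)%R by rewrite /a mulr_ge0 ?powR_ge0.
have xgt0 : (0 < x)%R.
  by rewrite lt_neqAle x0 andbT; apply: contraTneq ax => <-; rewrite mulr0 -leNgt.
have ax' : (a / x < (d / O) `^ p)%R by rewrite ltr_pdivrMr.
set m := ((a / x + (d / O) `^ p) / 2)%R.
have m1 : (a / x < m)%R by rewrite /m; lra.
have m2 : (m < (d / O) `^ p)%R by rewrite /m; lra.
have m0 : (0 < m)%R by apply: le_lt_trans m1; rewrite divr_ge0.
have mp : ((m `^ p^-1) `^ p = m)%R.
  by rewrite -powRrM mulVf ?gt_eqF// powRr1// ltW.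
have := K (m `^ p^-1)%R; rewrite powR_gt0// mp => /(_ isT).
rewrite -EFinM -EFinM lee_fin -/a leNgt -ltr_pdivrMr// m1 => H1.
suff /H1 : (m `^ p^-1 * O)%:E < d%:E by [].
rewrite lte_fin -ltr_pdivlMr// ltNge; apply/negP => dm.
move: m2; rewrite ltNge -mp => /negP; apply.
by apply: ge0_ler_powR; rewrite ?nnegrE ?(ltW p0) ?powR_ge0 ?divr_ge0 ?(ltW O0).
Qed.

End Level.

Lemma cond_of_weak_bound :
  H * tail_int (pdual q w v) r `^ (p - 1) <= ((C * O) `^ p)%:E.
Proof.
have K := trunc_int_bound.
have md n : measurable_fun setT (fun s : measurableTypeR R => (trunc_dual q n (pw w s) (b s))%:E).
  apply/measurable_EFinP; apply: measurable_funM.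
    by apply: measurable_trunc_test; [exact: measurable_pw|exact: measurable_id_pw|exact: pw_ge0].
  by apply: measurable_minr; [exact: measurable_pw|exact: measurable_cst].
have td0 n s : 0 <= (trunc_dual q n (pw w s) (b s))%:E.
  by rewrite lee_fin trunc_dual_ge0// pw_ge0.
have tnd s : {homo (fun n => (trunc_dual q n (pw w s) (b s))%:E) : n m / (n <= m)%N >-> n <= m}.
  by move=> n m nm; rewrite lee_fin; apply: trunc_dual_nd => //; exact: pw_ge0.
have DE : tail_int (pdual q w v) r = limn trunc_int.
  rewrite /trunc_int -monotone_convergence//; last by move=> n; exact: measurable_funTS.
  apply: eq_integral => s _; symmetry; apply: cvg_lim => //.
  by apply: trunc_dual_cvg => //; [exact: pw_ge0|exact: id_pw_ge0].
have cv : cvgn trunc_int.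
  apply: ereal_nondecreasing_is_cvgn => n m nm.
  by apply: ge0_le_integral_nonmeasurable => s _; [exact: td0|exact: tnd].
have [H00|Hn0] := eqVneq H 0; first by rewrite H00 mul0e lee_fin powR_ge0.
move: K H0 Hfin Hn0; case: H => // x K x0 _ xn0; rewrite !lee_fin in x0.
have xgt0 : (0 < x)%R by rewrite lt_neqAle eq_sym x0 andbT.
have pp : (0 < p - 1)%R by rewrite subr_gt0.
set M : R := (((C * O) `^ p / x) `^ (p - 1)^-1)%R.
have MD : tail_int (pdual q w v) r <= M%:E.
  rewrite DE; apply: lime_le => //; apply: nearW => n.
  have := K n; rewrite -lee_pdivlMr// => Kn.
  have T0 : 0 <= trunc_int n by apply: integral_ge0.
  have -> : trunc_int n = (trunc_int n `^ (p - 1)) `^ (p - 1)^-1.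
    by rewrite -poweRrM mulfV ?gt_eqF// poweRe1.
  rewrite /M -poweR_EFin; apply: gt0_ler_poweR; rewrite ?in_itv/= ?leey ?andbT ?poweR_ge0//.
  - by rewrite invr_ge0 ltW.
  - by rewrite lee_fin divr_ge0 ?powR_ge0.
have Mp : (M `^ (p - 1) = (C * O) `^ p / x)%R.
  by rewrite /M -powRrM mulVf ?gt_eqF// powRr1// divr_ge0 ?powR_ge0.
apply: (@le_trans _ _ (x%:E * (M `^ (p - 1))%:E)).
  apply: lee_wpmul2l; first by rewrite lee_fin.
  rewrite -poweR_EFin; apply: gt0_ler_poweR; rewrite ?in_itv/= ?leey ?andbT ?(ltW pp)//.
  - apply: integral_ge0 => s _; apply: dual_value_ge0; [exact: pw_ge0|exact: id_pw_ge0].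
  - by rewrite lee_fin powR_ge0.
by rewrite -EFinM lee_fin Mp mulrC divfK// gt_eqF.
Qed.

End Necessity.

(** * Comparison of the constants *)

Section Suprema.
Local Open Scope ereal_scope.
Variables (R : realType) (p q : R).
Hypotheses (p1 : (1 < p)%R) (hpq : (p^-1 + q^-1 = 1)%R).

Let p0 : (0 < p)%R. Proof. exact: lt_trans p1. Qed.
Let pp0 : (0 < p - 1)%R. Proof. by rewrite subr_gt0. Qed.

Lemma poweR_term_le (A Y : \bar R) (N : R) : 0 <= A -> 0 <= Y -> (0 <= N)%R ->
  (A `^ p^-1 * Y `^ q^-1 <= N%:E) <-> (A * Y `^ (p - 1) <= (N `^ p)%:E).
Proof.
move=> A0 Y0 N0; have [_ q0 q1 pq] := conj_exponent p1 hpq.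
have E : (A `^ p^-1 * Y `^ q^-1) `^ p = A * Y `^ (p - 1).
  rewrite poweRM ?poweR_ge0// -!poweRrM mulVf ?gt_eqF// poweRe1//.
  by rewrite [(q^-1 * p)%R]mulrC pq.
have T0 : 0 <= A `^ p^-1 * Y `^ q^-1 by rewrite mule_ge0 ?poweR_ge0.
rewrite -E -poweR_EFin; split => le.
  by apply: gt0_ler_poweR; rewrite ?in_itv/= ?leey ?andbT ?lee_fin ?(ltW p0).
have K (x : \bar R) : 0 <= x -> x = (x `^ p) `^ p^-1.
  by move=> x0; rewrite -poweRrM mulfV ?gt_eqF// poweRe1.
have N0' : 0 <= N%:E by rewrite lee_fin.
rewrite (K _ T0) [leRHS](K _ N0'); apply: gt0_ler_poweR => //.
- by rewrite invr_ge0 ltW.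
- by rewrite in_itv/= leey poweR_ge0.
- by rewrite in_itv/= leey andbT lee_fin powR_ge0.
Qed.

Lemma ereal_quotient (Z : \bar R) (k : R) : 0 < Z -> (0 <= k)%R ->
  exists B : R, [/\ (0 <= B)%R, B%:E * Z <= k%:E &
    forall X, 0 <= X -> X * Z <= k%:E -> X <= B%:E].
Proof.
move=> Z0 k0; case: Z Z0 => [z| |] //; last first.
  move=> _; exists 0%R; split; rewrite ?mul0e ?lee_fin// => X X0.
  have [->//|Xn0] := eqVneq X 0.
  by rewrite gt0_muley ?lt0e ?Xn0.
rewrite lte_fin => z0; exists (k / z)%R; split.
- by rewrite divr_ge0// ltW.
- by rewrite -EFinM divfK// gt_eqF.
- by move=> X _; rewrite EFinM lee_pdivlMr.
Qed.

Section Weights.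
Variables w v h : R[i] -> R.
Hypotheses (ww : radial_weight w) (wv : radial_weight v) (wh : radial_weight h).

Let D r := tail_int (pdual q w v) r.
Let H t r := \int[@leb R]_(s in `[t, r]) (s * pw h s)%:E.

Let pd0 s : 0 <= pdual q w v s.
Proof. by apply: dual_value_ge0; [exact: pw_ge0|exact: id_pw_ge0]. Qed.

Let D0 r : 0 <= D r. Proof. by apply: integral_ge0 => s _; exact: pd0. Qed.

Let H0 t r : 0 <= H t r.
Proof. by apply: integral_ge0 => s _; rewrite lee_fin id_pw_ge0. Qed.

Let Dle (r r' : R) : (r <= r')%R -> D r' <= D r.
Proof.
apply: tail_int_le => //.
by apply: measurable_dual_value; [exact: measurable_pw|exact: measurable_id_pw|exact: id_pw_ge0].
Qed.

Let tail_fin (t s : R) : (0 <= t)%R -> (t <= s)%R -> tail w t < +oo ->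
  tail w s = (rtail w s)%:E.
Proof.
move=> t0 ts tt; have s0 := le_trans t0 ts.
rewrite /rtail fineK// ge0_fin_numE ?(le_lt_trans (tail_le ww t0 ts))//.
by rewrite tailE//; apply: integral_ge0 => x _; rewrite lee_fin pw_ge0.
Qed.

Lemma Np_leP (N : R) : (0 <= N)%R -> Np p q w v h <= N%:E <->
  (forall t r : R, (0 <= t)%R -> (t < r)%R -> (r < 1)%R -> tail w t < +oo ->
    H t r * D r `^ (p - 1) <= ((N * rtail w t) `^ p)%:E).
Proof.
move=> N0.
have term (t r : R) : (0 <= t)%R -> (t < r)%R -> (r < 1)%R ->
    (((\int[@leb R]_(s in `[t, r]) (h s%:C%C * s)%:E) / (tail w t `^ p)) `^ (p^-1)%R *
      (dual_int q w v r) `^ (q^-1)%R <= N%:E) <->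
    (tail w t < +oo -> H t r * D r `^ (p - 1) <= ((N * rtail w t) `^ p)%:E).
  move=> t0 tr r1; have r0 : (0 <= r)%R by rewrite (le_trans t0)// ltW.
  rewrite (segment_intE wh t0 r1) -/(H t r) (dual_intE _ ww wv r0) -/(D r).
  have T0 : 0 < tail w t by rewrite tail_gt0// t0 (lt_trans tr).
  have I0 : 0 <= (tail w t `^ p)^-1 by rewrite inve_ge0 poweR_ge0.
  have := poweR_term_le (mule_ge0 (H0 t r) I0) (D0 r) N0; move=> ->.
  have [tt|] := ltP (tail w t) +oo; last first.
    rewrite leye_eq => /eqP ->; rewrite poweRyr ?gt_eqF// invey mule0 mul0e.
    by rewrite lee_fin powR_ge0.
  have E := tail_fin t0 (lexx t) tt; have O0 : (0 < rtail w t)%R by rewrite -lte_fin -E.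
  rewrite E poweR_EFin powRM ?(ltW O0)//.
  have Op : (0 < rtail w t `^ p)%R by rewrite powR_gt0.
  rewrite inver gt_eqF// muleAC EFinM -lee_pdivrMr//; split => //; exact.
split => [le t r t0 tr r1|le].
  apply/(term t r t0 tr r1); apply: le_trans le; apply: ereal_sup_ubound.
  by exists t, r; split.
apply: ge_ereal_sup => _ [t [r [t0 tr r1 ->]]].
by apply/(term t r t0 tr r1); exact: le.
Qed.

Lemma Np_ge0 : 0 <= Np p q w v h.
Proof.
apply: (@le_trans _ _ _ _ _ (mule_ge0 (poweR_ge0 _ _) (poweR_ge0 _ _))).
by apply: ereal_sup_ubound; exists 0%R, 2^-1%R; split => //; rewrite ?invr_gt0// invf_lt1// ltr1n.
Qed.

Section Epsilon.
Variable eps : R.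
Hypothesis eps0 : (0 < eps)%R.

Let F (s : R) : \bar R := (s * pw h s)%:E * (rtail w s `^ (- (p + eps)))%:E.

Let F0 s : 0 <= F s.
Proof. by rewrite mule_ge0// lee_fin ?id_pw_ge0 ?powR_ge0. Qed.

Let J r := \int[@leb R]_(s in `]0%R, r]) F s.

Let J0 r : 0 <= J r. Proof. by apply: integral_ge0 => s _; exact: F0. Qed.

Lemma Mp_leP (M : R) : (0 <= M)%R -> Mp p q eps w v h <= M%:E <->
  (forall r : R, (0 < r < 1)%R ->
    (rtail w r `^ eps)%:E * J r * D r `^ (p - 1) <= (M `^ p)%:E).
Proof.
move=> M0.
have FE (r : R) : (0 <= r < 1)%R -> \int[@leb R]_(s in `[0%R, r])
    ((s * h s%:C%C)%:E / (tail w s `^ (p + eps)%R)) = J r.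
  move=> /andP[r0 r1]; rewrite /J [LHS]integral_mkcond [RHS]integral_mkcond.
  apply: eq_integral => s _; rewrite !patchE.
  have [s0|s0] := leP s 0%R.
    rewrite [RHS]ifF; last by apply/negbTE; rewrite notin_setE/= in_itv/= ltNge s0.
    case: ifPn => //; rewrite inE/= in_itv/= => /andP[s0' _].
    have -> : s = 0%R by apply/eqP; rewrite eq_le s0.
    by rewrite mul0r mul0e.
  case: ifPn; last first.
    rewrite notin_setE/= in_itv/= (ltW s0)/= => sr; rewrite ifF//.
    by apply/negbTE; rewrite notin_setE/= in_itv/= s0.
  rewrite inE/= in_itv/= (ltW s0)/= => sr; have s1 := le_lt_trans sr r1.
  rewrite mem_set; last by rewrite /= in_itv/= s0.
  have O0 : (0 < rtail w s)%R by rewrite rtail_gt0 ?s0.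
  rewrite /F /pw s0 s1/= (rtailE ww s0) poweR_EFin powRN inver gt_eqF//.
  exact: powR_gt0.
have term (r : R) : (0 <= r < 1)%R ->
    ((tail w r `^ eps *
          \int[@leb R]_(s in `[0%R, r])
            ((s * h s%:C%C)%:E / (tail w s `^ (p + eps)%R)))
          `^ (p^-1)%R * (dual_int q w v r) `^ (q^-1)%R <= M%:E) <->
    (tail w r `^ eps * J r * D r `^ (p - 1) <= (M `^ p)%:E).
  move=> r01; have /andP[r0 r1] := r01.
  rewrite FE// (dual_intE _ ww wv r0) -/(D r).
  exact: (poweR_term_le (mule_ge0 (poweR_ge0 _ _) (J0 r)) (D0 r) M0).
split => [le r /andP[r0 r1]|le].
  rewrite -poweR_EFin -(rtailE ww r0); apply/term; first by rewrite ltW.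
  apply: le_trans le; apply: ereal_sup_ubound.
  by exists r; split => //; exact: ltW.
apply: ge_ereal_sup => _ [r [r0 r1 ->]]; apply/term; first by rewrite r0.
move: r0; rewrite le_eqVlt => /predU1P[<-|r0].
  by rewrite /J set_itv_ge ?bnd_simp ?ltxx// integral_set0 mule0 mul0e lee_fin powR_ge0.
by rewrite (rtailE ww r0) poweR_EFin; apply: le; rewrite r0.
Qed.

Let mH : measurable_fun setT (fun s : measurableTypeR R => (s * pw h s)%:E).
Proof. by apply/measurable_EFinP; exact: measurable_id_pw. Qed.

Let mrtail (S : set (measurableTypeR R)) (t : R) : (0 <= t)%R -> tail w t < +oo ->
  is_interval (S : set R) -> (forall s, S s -> t <= s)%R ->
  measurable_fun S (rtail w : measurableTypeR R -> measurableTypeR R).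
Proof.
move=> t0 tt iS St; apply/measurable_EFinP; apply: nonincreasing_on_emeasurable => //.
move=> s s' Ss Ss' ss' /=; have ts := St _ Ss.
rewrite -(tail_fin t0 ts tt) -(tail_fin t0 (le_trans ts ss') tt).
by apply: tail_le => //; exact: le_trans ts.
Qed.

Definition NM_const : R := (2 `^ p / (1 - 2 `^ (- eps)))%R.
Definition MN_const : R := (2 `^ eps / (1 - 2 `^ (- p)))%R.

Lemma Mp_le_of_Np (N : R) : (0 <= N)%R -> Np p q w v h <= N%:E ->
  Mp p q eps w v h <= (NM_const `^ p^-1 * N)%:E.
Proof.
move=> N0 /(Np_leP N0) le.
have K0 : (0 <= NM_const)%R.
  by rewrite divr_ge0 ?powR_ge0// subr_ge0 ltW//; case/andP: (powR2N_lt1 eps0).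
apply/Mp_leP; first by rewrite mulr_ge0 ?powR_ge0.
move=> r r01; have /andP[r0 r1] := r01; have O0 := rtail_gt0 ww r01.
rewrite powRM ?powR_ge0// -powRrM mulVf ?gt_eqF// powRr1//.
have [Z0|Zn0] := eqVneq (D r `^ (p - 1)) 0.
  by rewrite Z0 mule0 lee_fin mulr_ge0 ?powR_ge0.
have Z0 : 0 < D r `^ (p - 1) by rewrite lt0e Zn0 poweR_ge0.
have [B [B0 BZ BX]] := ereal_quotient Z0 (powR_ge0 N p).
have JB : J r <= (B * 2 `^ p / (1 - 2 `^ (- eps)) * rtail w r `^ (- eps))%:E.
  apply: (@weighted_integral_bound R (fun s => (s * pw h s)%:E) (rtail w) p eps) => //.
  - by move=> s; rewrite lee_fin id_pw_ge0.
  - by move=> s /andP[s0 sr]; rewrite rtail_gt0// s0 (le_lt_trans sr).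
  - by move=> s s' s0 ss' _; exact: rtail_le.
  - have iD : is_interval (`]0%R, r]%classic : set R) by exact: interval_is_interval.
    apply/measurable_EFinP; apply: nonincreasing_on_emeasurable => //.
    move=> s s'; rewrite /= !in_itv/= => /andP[s0 _] _ ss'.
    by rewrite lee_fin rtail_le.
  move=> t /andP[t0 tr].
  have Ot : (0 < rtail w t)%R by rewrite rtail_gt0// t0 (lt_trans tr).
  have Op : (0 < rtail w t `^ p)%R by rewrite powR_gt0.
  rewrite EFinM -lee_pdivrMr//; apply: BX.
    by rewrite mule_ge0 ?lee_fin ?invr_ge0 ?powR_ge0//; exact: H0.
  rewrite muleAC lee_pdivrMr// -EFinM -powRM ?(ltW Ot)//.
  by apply: le => //; [exact: ltW|exact: tail_lty].
apply: (@le_trans _ _ ((rtail w r `^ eps)%:E *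
   (B * 2 `^ p / (1 - 2 `^ (- eps)) * rtail w r `^ (- eps))%:E * D r `^ (p - 1))).
  by apply: lee_wpmul2r; [exact: poweR_ge0|apply: lee_wpmul2l => //; rewrite lee_fin powR_ge0].
have -> : (rtail w r `^ eps)%:E * (B * 2 `^ p / (1 - 2 `^ (- eps)) * rtail w r `^ (- eps))%:E =
    (NM_const * B)%:E.
  rewrite -EFinM; congr EFin; rewrite (powRN (rtail w r)) /NM_const.
  have /andP[_ e1] := powR2N_lt1 eps0.
  have Oe : (rtail w r `^ eps != 0)%R by rewrite gt_eqF// powR_gt0.
  have e1' : (1 - 2 `^ (- eps) != 0 :> R)%R by rewrite gt_eqF// subr_gt0.
  by field; apply/andP.
rewrite [(NM_const * B)%:E]EFinM -muleA [leRHS]EFinM.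
by apply: lee_wpmul2l => //; rewrite lee_fin.
Qed.

Lemma Np_le_of_Mp (M : R) : (0 <= M)%R -> Mp p q eps w v h <= M%:E ->
  Np p q w v h <= (MN_const `^ p^-1 * M)%:E.
Proof.
move=> M0 /(Mp_leP M0) le.
have K0 : (0 <= MN_const)%R.
  by rewrite divr_ge0 ?powR_ge0// subr_ge0 ltW//; case/andP: (powR2N_lt1 p0).
apply/Np_leP; first by rewrite mulr_ge0 ?powR_ge0.
move=> t r t0 tr r1 tt.
have t1 : (t < 1)%R := lt_trans tr r1.
have Ofin s : (t <= s)%R -> tail w s = (rtail w s)%:E by move=> ts; exact: tail_fin tt.
have O0 s : (t <= s < 1)%R -> (0 < rtail w s)%R.
  by move=> /andP[ts s1]; rewrite -lte_fin -Ofin// tail_gt0// s1 (le_trans t0).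
have Ole s s' : (t <= s)%R -> (s <= s')%R -> (rtail w s' <= rtail w s)%R.
  move=> ts ss'; rewrite -lee_fin -!Ofin// ?(le_trans ts)//.
  by apply: tail_le => //; exact: le_trans ts.
have Ot : (0 < rtail w t)%R by rewrite O0// lexx.
have KM0 : (0 <= MN_const `^ p^-1 * M)%R by rewrite mulr_ge0 ?powR_ge0.
rewrite (powRM p KM0 (ltW Ot)) (powRM p (powR_ge0 _ _) M0).
rewrite -powRrM mulVf ?gt_eqF// powRr1//.
have [Z0|Zn0] := eqVneq (D r `^ (p - 1)) 0.
  rewrite Z0 mule0 lee_fin.
  exact: (mulr_ge0 (mulr_ge0 K0 (powR_ge0 _ _)) (powR_ge0 _ _)).
have Z0 : 0 < D r `^ (p - 1) by rewrite lt0e Zn0 poweR_ge0.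
have [B [B0 BZ BX]] := ereal_quotient Z0 (powR_ge0 M p).
have HB : H t r <= (B * 2 `^ eps / (1 - 2 `^ (- p)) * rtail w t `^ p)%:E.
  apply: (@segment_integral_bound R (fun s => (s * pw h s)%:E) (rtail w) p eps) => //.
  - by move=> s; rewrite lee_fin id_pw_ge0.
  - by move=> s /andP[ts sr]; rewrite O0// ts (le_lt_trans sr).
  - by move=> s s' ts ss' _; exact: Ole.
  - apply: (mrtail t0 tt); first exact: interval_is_interval.
    by move=> s /=; rewrite in_itv/= => /andP[].
  move=> t' r' tt' t'r' r'r.
  have r'0 : (0 < r')%R by rewrite (le_lt_trans t0)// (le_lt_trans tt').
  have r'1 : (r' < 1)%R := le_lt_trans r'r r1.
  have t'0 : (0 <= t')%R := le_trans t0 tt'.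
  have Ot' : (0 < rtail w t')%R by rewrite O0// tt' (lt_trans t'r').
  have Or' : (0 < rtail w r')%R by rewrite rtail_gt0 ?r'0.
  have XB : (rtail w r' `^ eps)%:E * J r' <= B%:E.
    apply: BX; first by rewrite mule_ge0 ?lee_fin ?powR_ge0//; exact: J0.
    apply: le_trans (le r' _); last by rewrite r'0.
    apply: lee_wpmul2l; first by rewrite mule_ge0 ?lee_fin ?powR_ge0//; exact: J0.
    apply: gt0_ler_poweR; rewrite ?in_itv/= ?leey ?andbT ?(ltW pp0)//; try exact: D0.
    exact: Dle.
  have JB : J r' <= (B / rtail w r' `^ eps)%:E.
    by rewrite EFinM lee_pdivlMr ?powR_gt0// muleC.
  have HJ : \int[@leb R]_(s in `[t', r']) (s * pw h s)%:E <= (rtail w t' `^ (p + eps))%:E * J r'.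
    have mS : measurable (`]0%R, r']%classic : set (measurableTypeR R)) by exact: measurable_itv.
    have mF : measurable_fun (`]0%R, r']%classic : set (measurableTypeR R)) (F : measurableTypeR R -> \bar R).
      apply: emeasurable_funM; first exact: measurable_funTS.
      have mO : measurable_fun (`]0%R, r']%classic : set (measurableTypeR R))
          (rtail w : measurableTypeR R -> measurableTypeR R).
        apply/measurable_EFinP; apply: nonincreasing_on_emeasurable.
          exact: interval_is_interval.
        move=> s s'; rewrite /= !in_itv/= => /andP[s0 _] _ ss'.
        by rewrite lee_fin rtail_le.
      apply/measurable_EFinP; exact: (measurableT_comp (@measurable_powR R (- (p + eps))) mO).
    rewrite /J -ge0_integralZl//; last by rewrite lee_fin powR_ge0.
    rewrite [leLHS]integral_mkcond [leRHS]integral_mkcond.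
    apply: ge0_le_integral_nonmeasurable => s _.
      by apply: erestrict_ge0 => {}s _; rewrite lee_fin id_pw_ge0.
    have R0 : 0 <= ((fun s : R => (rtail w t' `^ (p + eps))%:E * F s) \_ `]0%R, r']) s.
      by apply: erestrict_ge0 => {}s _; rewrite mule_ge0 ?lee_fin ?powR_ge0//; exact: F0.
    rewrite patchE; case: ifPn => //; rewrite inE/= in_itv/= => /andP[t's sr'].
    have [s0|s0] := leP s 0%R.
      by rewrite /pw ltNge s0/= mulr0.
    rewrite patchE mem_set; last by rewrite /= in_itv/= s0.
    rewrite /F -!EFinM lee_fin mulrCA ler_peMr ?id_pw_ge0//.
    have s1 : (s < 1)%R := le_lt_trans sr' r'1.
    have Os : (0 < rtail w s)%R by rewrite rtail_gt0 ?s0.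
    rewrite powRN ler_pdivlMr ?powR_gt0// mul1r.
    apply: ge0_ler_powR; rewrite ?nnegrE ?(ltW Os) ?(ltW Ot')//.
      by rewrite addr_ge0 ?(ltW p0) ?(ltW eps0).
    exact: Ole.
  apply: (le_trans HJ); apply: (@le_trans _ _ ((rtail w t' `^ (p + eps))%:E * (B / rtail w r' `^ eps)%:E)).
    by apply: lee_wpmul2l => //; rewrite lee_fin powR_ge0.
  rewrite -EFinM lee_fin powRM ?invr_ge0 ?(ltW Ot') ?(ltW Or')// powRD; last by rewrite (gt_eqF Ot') implybT.
  rewrite -(powR_inv1 (ltW Or')) -powRrM mulN1r powRN.
  by rewrite le_eqVlt; apply/orP; left; apply/eqP; ring.
apply: le_trans (lee_wpmul2r (poweR_ge0 _ _) HB) _.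
have -> : (B * 2 `^ eps / (1 - 2 `^ (- p)) * rtail w t `^ p = MN_const * rtail w t `^ p * B)%R.
  by rewrite /MN_const; ring.
rewrite [(MN_const * _ * B)%:E]EFinM -muleA.
have -> : (MN_const * M `^ p * rtail w t `^ p = MN_const * rtail w t `^ p * M `^ p)%R by ring.
rewrite [leRHS]EFinM; apply: lee_wpmul2l => //.
by rewrite lee_fin; exact: (mulr_ge0 K0 (powR_ge0 _ _)).
Qed.

Lemma Mp_ge0 : 0 <= Mp p q eps w v h.
Proof.
apply: (@le_trans _ _ _ _ _ (mule_ge0 (poweR_ge0 _ _) (poweR_ge0 _ _))).
by apply: ereal_sup_ubound; exists 0%R; split.
Qed.

End Epsilon.
End Weights.
End Suprema.

Section Comparison.
Local Open Scope ereal_scope.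
Variable R : realType.

Lemma le_mul_of_real_bounds (X Y : \bar R) (K : R) : 0 <= X -> (0 < K)%R ->
  (forall N : R, (0 < N)%R -> X <= N%:E -> Y <= (K * N)%:E) -> Y <= K%:E * X.
Proof.
move=> X0 K0 le; case: X X0 le => [x| |] // x0 le; last by rewrite gt0_muley ?leey ?lte_fin.
rewrite lee_fin in x0; apply/lee_addgt0Pr => e e0.
have eK : (0 < e / K)%R by rewrite divr_gt0.
rewrite -EFinM -EFinD.
have -> : (K * x + e = K * (x + e / K))%R by field; rewrite gt_eqF.
by apply: le; [rewrite ltr_wpDl|rewrite lee_fin lerDl ltW].
Qed.

Variables (p q : R) (w v h : R[i] -> R).
Hypotheses (p1 : (1 < p)%R) (hpq : (p^-1 + q^-1 = 1)%R).
Hypotheses (ww : radial_weight w) (wv : radial_weight v) (wh : radial_weight h).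

Lemma weak_bound_of_Np (N : R) : (0 < N)%R -> Np p q w v h <= N%:E ->
  weak_bound p w v h (16 * N).
Proof.
move=> N0 /(Np_leP p1 hpq ww wv wh (ltW N0)) le.
apply: (weak_bound_of_cond p1 hpq N0 ww wv wh) => t r t0 tr r1.
by apply: le => //; [exact: ltW|exact: tail_lty].
Qed.

Lemma Np_le_of_weak_bound (C : R) : (0 <= C)%R -> weak_bound p w v h C ->
  Np p q w v h <= C%:E.
Proof.
move=> C0 wb; apply/(Np_leP p1 hpq ww wv wh C0) => t r t0 tr r1 tt.
by apply: cond_of_weak_bound.
Qed.

Lemma Tavg_norm_ge0 : 0 <= Tavg_norm p w v h.
Proof. by apply: le_ereal_inf_tmp => _ [C [C0 _] <-]; rewrite lee_fin. Qed.

Lemma Tavg_norm_le_Np : Tavg_norm p w v h <= 16%:E * Np p q w v h.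
Proof.
apply: le_mul_of_real_bounds => //; first exact: Np_ge0.
move=> N N0 le; apply: ereal_inf_lbound; exists (16 * N)%R => //.
by split; [rewrite mulr_ge0 ?(ltW N0)|exact: weak_bound_of_Np].
Qed.

Lemma Np_le_Tavg_norm : Np p q w v h <= Tavg_norm p w v h.
Proof.
apply: le_ereal_inf_tmp => _ [C [C0 wb] <-]; exact: Np_le_of_weak_bound.
Qed.

Lemma Tavg_bounded_iff_Np : Tavg_bounded p w v h <-> Np p q w v h < +oo.
Proof.
split=> [[C C0 wb]|Nfin].
  exact: le_lt_trans (Np_le_of_weak_bound C0 wb) (ltry _).
have N0 := Np_ge0 p q w v h.
have NE : Np p q w v h = (fine (Np p q w v h))%:E by rewrite fineK// ge0_fin_numE.
have n0 : (0 <= fine (Np p q w v h))%R by rewrite fine_ge0.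
have n1 : (0 < fine (Np p q w v h) + 1)%R by rewrite ltr_wpDl.
exists (16 * (fine (Np p q w v h) + 1))%R; first by rewrite mulr_ge0 ?(ltW n1).
by apply: weak_bound_of_Np => //; rewrite {1}NE lee_fin lerDl.
Qed.

Section Epsilon.
Variable eps : R.
Hypothesis eps0 : (0 < eps)%R.

Let K1 : R := (NM_const p eps `^ p^-1)%R.
Let K2 : R := (MN_const p eps `^ p^-1)%R.

Let p0 : (0 < p)%R. Proof. exact: lt_trans p1. Qed.

Lemma NM_factor_gt0 : (0 < NM_const p eps `^ p^-1)%R.
Proof.
by rewrite powR_gt0// divr_gt0 ?powR_gt0// subr_gt0; case/andP: (powR2N_lt1 eps0).
Qed.

Lemma MN_factor_gt0 : (0 < MN_const p eps `^ p^-1)%R.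
Proof.
by rewrite powR_gt0// divr_gt0 ?powR_gt0// subr_gt0; case/andP: (powR2N_lt1 p0).
Qed.

Lemma Mp_le_Np : Mp p q eps w v h <= K1%:E * Np p q w v h.
Proof.
apply: le_mul_of_real_bounds; [exact: Np_ge0|exact: NM_factor_gt0|].
by move=> N N0 le; apply: Mp_le_of_Np => //; exact: ltW.
Qed.

Lemma Np_le_Mp : Np p q w v h <= K2%:E * Mp p q eps w v h.
Proof.
apply: le_mul_of_real_bounds; [exact: Mp_ge0|exact: MN_factor_gt0|].
by move=> N N0 le; apply: Np_le_of_Mp => //; exact: ltW.
Qed.

Lemma Np_lty_iff_Mp : Np p q w v h < +oo <-> Mp p q eps w v h < +oo.
Proof.
split => fin.
  apply: le_lt_trans Mp_le_Np _; apply: lte_mul_pinfty => //.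
  by rewrite lee_fin powR_ge0.
apply: le_lt_trans Np_le_Mp _; apply: lte_mul_pinfty => //.
by rewrite lee_fin powR_ge0.
Qed.

End Epsilon.
End Comparison.

(* The comparison constant K depends only on p and eps, not on the weights. *)
Theorem theorem3 (R : realType) (p q : R) (hp : 1 < p)
    (hpq : p^-1 + q^-1 = 1) :
  (forall w v h : R[i] -> R,
     radial_weight w -> radial_weight v -> radial_weight h ->
     [/\ Tavg_bounded p w v h <-> (Np p q w v h < +oo)%E,
         Tavg_bounded p w v h <->
           (exists2 eps : R, 0 < eps & (Mp p q eps w v h < +oo)%E) &
         Tavg_bounded p w v h <->
           (forall eps : R, 0 < eps -> (Mp p q eps w v h < +oo)%E)]) /\
  (forall eps : R, 0 < eps ->
     exists2 K : R, 0 < K &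
       forall w v h : R[i] -> R,
         radial_weight w -> radial_weight v -> radial_weight h ->
         [/\ (Tavg_norm p w v h <= K%:E * Np p q w v h)%E,
             (Np p q w v h <= K%:E * Tavg_norm p w v h)%E,
             (Np p q w v h <= K%:E * Mp p q eps w v h)%E &
             (Mp p q eps w v h <= K%:E * Np p q w v h)%E]).
Proof.
split=> [w v h ww wv wh|eps eps0].
  have bN := Tavg_bounded_iff_Np hp hpq ww wv wh.
  have NM (eps : R) (eps0 : 0 < eps) := Np_lty_iff_Mp hp hpq ww wv wh eps0.
  split; first exact: bN.
  - rewrite bN; split => [Nfin|[eps eps0 Mfin]]; last exact/(NM _ eps0).
    by exists 1; [exact: ltr01|exact/(NM _ ltr01)].
  - rewrite bN; split => [Nfin eps eps0|Mfin]; first exact/(NM _ eps0).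
    exact/(NM _ ltr01)/Mfin/ltr01.
set a := NM_const p eps `^ p^-1; set b := MN_const p eps `^ p^-1.
pose K := Num.max 16 (Num.max a b).
have max_gel (x y : R) : x <= Num.max x y by rewrite le_max lexx.
have max_ger (x y : R) : y <= Num.max x y by rewrite le_max lexx orbT.
have K_ge16 : 16 <= K := max_gel _ _.
have K_gea : a <= K := le_trans (max_gel a b) (max_ger _ _).
have K_geb : b <= K := le_trans (max_ger a b) (max_ger _ _).
have K_ge1 : 1 <= K by apply: le_trans K_ge16; rewrite ler1n.
have enlarge (X Y : \bar R) (c : R) : (0 <= X)%E -> c <= K -> (Y <= c%:E * X)%E ->
    (Y <= K%:E * X)%E.
  by move=> X0 cK /le_trans; apply; apply: lee_wpmul2r => //; rewrite lee_fin.
exists K; first exact: lt_le_trans ltr01 K_ge1.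
move=> w v h ww wv wh; split.
- apply: (enlarge _ _ 16); [exact: Np_ge0|exact: K_ge16|].
  exact: (Tavg_norm_le_Np hp hpq ww wv wh).
- apply: (enlarge _ _ 1); [exact: Tavg_norm_ge0|exact: K_ge1|].
  by rewrite mul1e; exact: (Np_le_Tavg_norm hp hpq ww wv wh).
- apply: (enlarge _ _ b); [exact: Mp_ge0|exact: K_geb|].
  exact: (Np_le_Mp hp hpq ww wv wh eps0).
- apply: (enlarge _ _ a); [exact: Np_ge0|exact: K_gea|].
  exact: (Mp_le_Np hp hpq ww wv wh eps0).
Qed.
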